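(* Let $K$ be an algebraically closed field, complete with respect to a non-archimedean absolute value $|\cdot|$, with valuation ring $\mathcal{O}$, maximal ideal $\mathfrak{m}$ and residue field $k=\mathcal{O}/\mathfrak{m}$. Let $\varphi\in K(z)$ be a rational map of degree $2$, and let $\xi$ be the unique point of $\mathbb{P}^1_{\mathrm{Berk}}$ with $w_\varphi(\xi)>0$ (the unique point of the crucial set of $\varphi$). Let $\lambda_1,\lambda_2,\lambda_3$ be the multipliers of $\varphi$ at its three classical fixed points (listed with multiplicity), $\sigma_1=\lambda_1+\lambda_2+\lambda_3$, $\sigma_2=\lambda_1\lambda_2+\lambda_1\lambda_3+\lambda_2\lambda_3$, and $\mathbf{s}([\varphi])=[\sigma_1:\sigma_2:1]\in\mathbb{P}^2(K)$. Then: (A) $\widetilde{\mathbf{s}([\varphi])}\in\mathbb{A}^2(k)=\{[\tilde x:\tilde y:\tilde 1]\}$ if and only if $\xi$ satisfies (W1); (B) $\widetilde{\mathbf{s}([\varphi])}=[\tilde 1:\tilde x:\tilde 0]$ for some $\tilde x\in k$ with $\tilde x\neq\tilde 2$ if and only if $\xi$ satisfies (W2); in this case $\tilde x=\tilde\lambda+\tilde\lambda^{-1}$, where $\lambda$ is the multiplier of $\varphi$ at a classical indifferent fixed point; (C) $\widetilde{\mathbf{s}([\varphi])}=[\tilde 1:\tilde 2:\tilde 0]$ if and only if $\xi$ satisfies (W3); (D) $\widetilde{\mathbf{s}([\varphi])}=[\tilde 0:\tilde 1:\tilde 0]$ if and only if $\xi$ satisfies (W4).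
   Context: $\mathbb{P}^1_{\mathrm{Berk}}$ is the Berkovich projective line over $K$; for $a\in K$, $r>0$, $\zeta_{D(a,r)}$ denotes the point corresponding to the sup-norm on the disc $D(a,r)=\{x:|x-a|\le r\}$; it is of type II when $r\in|K^\times|$; $\zeta_G=\zeta_{D(0,1)}$ is the Gauss point. $\varphi$ acts continuously on $\mathbb{P}^1_{\mathrm{Berk}}$. For a rational map $\psi$, a normalized lift is a pair $[F,G]$ of homogeneous polynomials with coefficients in $\mathcal{O}$, at least one a unit, with $\psi=F(z,1)/G(z,1)$; the reduction $\tilde\psi$ is obtained by reducing the coefficients mod $\mathfrak{m}$ and cancelling common factors. For a type II point $P$, choose $\gamma\in\mathrm{PGL}_2(K)$ with $\gamma(\zeta_G)=P$ and set $\tilde\varphi_P:=\widetilde{\gamma^{-1}\circ\varphi\circ\gamma}$ (well-defined up to $\mathrm{PGL}_2(k)$-conjugacy). A type II point $P$ is fixed by $\varphi$ iff $\tilde\varphi_P$ is nonconstant. The tangent directions at a type II point $P$ correspond to $\mathbb{P}^1(k)$ and $\varphi_*$ acts on them via $\tilde\varphi_P$ when $P$ is fixed. Let $\Gamma_{\mathrm{Fix}}$ be the subtree of $\mathbb{P}^1_{\mathrm{Berk}}$ spanned by the classical fixed points of $\varphi$ and $\Gamma_{\mathrm{Fix,Repel}}$ the tree spanned by the classical fixed points and the type II fixed points $P$ with $\deg\tilde\varphi_P\ge2$; $v(P)$ is the valence of $P$ in $\Gamma_{\mathrm{Fix,Repel}}$ (0 if $P\notin\Gamma_{\mathrm{Fix,Repel}}$).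 Weights: if $P$ is a type II fixed point, $w_\varphi(P)=\deg\tilde\varphi_P-1+N(P)$, where $N(P)$ is the number of tangent directions at $P$ containing classical fixed points that are moved by $\varphi_*$; if $P$ is a branch point of $\Gamma_{\mathrm{Fix}}$ moved by $\varphi$, $w_\varphi(P)=v(P)-2$; otherwise $w_\varphi(P)=0$. The weights sum to $\deg\varphi-1=1$. Conditions on a type II point $P$: (W1) $P$ is fixed and $\deg\tilde\varphi_P\ge2$; (W2) $P$ is fixed, $\tilde\varphi_P$ is conjugate over $k$ to $z\mapsto \tilde c z$ with $\tilde c\in k^\times$, $\tilde c\ne\tilde1$, and $P$ is a branch point of $\Gamma_{\mathrm{Fix}}$; (W3) $P$ is fixed, $\tilde\varphi_P$ is conjugate to $z\mapsto z+\tilde a$ with $\tilde a\in k^\times$, and $P\in\Gamma_{\mathrm{Fix}}$; (W4) $P$ is a branch point of $\Gamma_{\mathrm{Fix}}$ moved by $\varphi$. The multiplier at a fixed point $\alpha$ is $\varphi'(\alpha)$ (computed in a coordinate chart at $\infty$ if needed); $\alpha$ is indifferent if $|\varphi'(\alpha)|=1$. For $P\in\mathbb{P}^2(K)$, $\tilde P\in\mathbb{P}^2(k)$ is its specialization: scale homogeneous coordinates to lie in $\mathcal{O}$ with one a unit and reduce mod $\mathfrak{m}$. *)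

(* Defs.v *)
From HB Require Import structures.
From mathcomp Require Import all_boot all_order all_algebra.
From mathcomp Require Import reals.
From Stdlib Require Import ClassicalEpsilon.
Set Implicit Arguments. Unset Strict Implicit. Unset Printing Implicit Defensive.
Import Order.TTheory GRing.Theory Num.Theory.
Local Open Scope ring_scope.

Record nonarch_abs (K : fieldType) (R : realType) := NonarchAbs {
  nabs :> K -> R;
  nabs_ge0 : forall x, 0 <= nabs x;
  nabs_eq0 : forall x, (nabs x == 0) = (x == 0);
  nabsM : forall x y, nabs (x * y) = nabs x * nabs y;
  nabs_ultra : forall x y, nabs (x + y) <= Num.max (nabs x) (nabs y);
  nabs_complete : forall u : nat -> K,
    (forall e : R, 0 < e -> exists N : nat, forall m n : nat,
        (N <= m)%N -> (N <= n)%N -> nabs (u m - u n) < e) ->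
    exists l : K, forall e : R, 0 < e -> exists N : nat, forall n : nat,
        (N <= n)%N -> nabs (u n - l) < e
}.

(* The residue field: k together with the reduction map O -> k, which is a
   surjective ring morphism on O = {|x| <= 1} with kernel m = {|x| < 1};
   hence k is (canonically isomorphic to) O/m. *)
Record residue_map (K : fieldType) (R : realType) (v : nonarch_abs K R)
    (k : fieldType) := ResidueMap {
  red :> K -> k;
  redD : forall x y, v x <= 1 -> v y <= 1 -> red (x + y) = red x + red y;
  redM : forall x y, v x <= 1 -> v y <= 1 -> red (x * y) = red x * red y;
  red1 : red 1 = 1;
  red_eq0 : forall x, v x <= 1 -> (red x == 0) = (v x < 1);
  red_surj : forall t : k, exists2 x, v x <= 1 & red x = t
}.

Definition fin_card (T : eqType) (P : T -> Prop) : nat :=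
  match excluded_middle_informative
          (exists s : seq T, uniq s /\ forall t, t \in s <-> P t) with
  | left h => size (proj1_sig (constructive_indefinite_description _ h))
  | right _ => 0%N
  end.

Section Defs.
Variables (R : realType) (K : fieldType) (v : nonarch_abs K R) (k : fieldType).
Variable (rd : residue_map v k).

Definition maxcoef (s : seq K) : K :=
  foldr (fun x m => if v m < v x then x else m) 0 s.

(* Reduction of a pair of (dehomogenized) forms [F,G] : normalize so that all
   coefficients are in O with one a unit, then reduce mod m.  A rational map
   over K or k is represented by such a pair (numerator, denominator). *)
Definition red_pair (f : {poly K} * {poly K}) : {poly k} * {poly k} :=
  let u := maxcoef (f.1 ++ f.2) in
  (map_poly (fun x => rd (x / u)) f.1, map_poly (fun x => rd (x / u)) f.2).

(* --- rational maps over k, as pairs (P, Q) not both zero --- *)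
Definition cancel_pair (f : {poly k} * {poly k}) : {poly k} * {poly k} :=
  let g := gcdp f.1 f.2 in (f.1 %/ g, f.2 %/ g).

Definition rdeg (f : {poly k} * {poly k}) : nat :=
  let h := cancel_pair f in (maxn (size h.1) (size h.2)).-1.

Definition pequiv (f g : {poly k} * {poly k}) : Prop := f.1 * g.2 = f.2 * g.1.

(* evaluation of the rational map on P^1(k) = option k (None = infinity) *)
Definition evalP1 (f : {poly k} * {poly k}) (t : option k) : option k :=
  let h := cancel_pair f in
  match t with
  | Some x => if h.2.[x] != 0 then Some (h.1.[x] / h.2.[x]) else None
  | None => let n := (maxn (size h.1) (size h.2)).-1 in
            if h.2`_n != 0 then Some (h.1`_n / h.2`_n) else None
  end.

(* f o rho, rho(z) = (al z + be)/(ga z + de), via the homogeneous form of f *)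
Definition hcomp (f : {poly k} * {poly k}) (al be ga de : k) :=
  let n := (maxn (size f.1) (size f.2)).-1 in
  (\sum_(i < n.+1) f.1`_i *: ((al *: 'X + be%:P) ^+ i * (ga *: 'X + de%:P) ^+ (n - i)),
   \sum_(i < n.+1) f.2`_i *: ((al *: 'X + be%:P) ^+ i * (ga *: 'X + de%:P) ^+ (n - i))).

Definition postmob (al be ga de : k) (g : {poly k} * {poly k}) :=
  (al *: g.1 + be *: g.2, ga *: g.1 + de *: g.2).

Definition conj_k (f g : {poly k} * {poly k}) : Prop :=
  exists al be ga de : k, al * de - be * ga != 0 /\
    pequiv (hcomp f al be ga de) (postmob al be ga de g).

(* --- the map phi = p/q over K; type II points zeta_{D(a,|c|)}, c != 0 --- *)
Variables (p q : {poly K}).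

(* gamma^-1 o phi o gamma with gamma(z) = a + c z (gamma(zeta_G) = zeta_{D(a,|c|)}) *)
Definition phi_conj (a c : K) : {poly K} * {poly K} :=
  let L := c *: 'X + a%:P in
  (comp_poly L p - a *: comp_poly L q, c *: comp_poly L q).

Definition phi_red (a c : K) := red_pair (phi_conj a c).

(* P is fixed iff tilde(phi)_P is nonconstant *)
Definition fixedII (a c : K) : Prop := (1 <= rdeg (phi_red a c))%N.

Definition same_pt (a c b d : K) : bool := (v c == v d) && (v (a - b) <= v c).

(* tangent direction at zeta_{D(a,|c|)} (identified with P^1(k) via gamma)
   containing the classical point b, resp. the type II point zeta_{D(b,|d|)} *)
Definition dir_cl (a c : K) (b : option K) : option k :=
  match b with
  | Some b => if v (b - a) <= v c then Some (rd ((b - a) / c)) else None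
  | None => None
  end.
Definition dir_II (a c b d : K) : option k :=
  if (v d <= v c) && (v (b - a) <= v c) then Some (rd ((b - a) / c)) else None.

(* fp : the classical fixed points *)
Variable fp : seq (option K).

Definition fixdirs (a c : K) : seq (option k) := undup [seq dir_cl a c b | b <- fp].
Definition in_GFix (a c : K) : Prop := (2 <= size (fixdirs a c))%N.
Definition branch_GFix (a c : K) : Prop := (3 <= size (fixdirs a c))%N.

Definition Nmoved (a c : K) : nat :=
  count (fun t => evalP1 (phi_red a c) t != t) (fixdirs a c).

Definition repelling (b d : K) : Prop := d != 0 /\ (2 <= rdeg (phi_red b d))%N.

(* directions at P meeting the spanning set of Gamma_Fix,Repel *)
Definition FRdir (a c : K) (t : option k) : Prop :=
  t \in fixdirs a c \/
  exists b d : K, repelling b d /\ ~~ same_pt a c b d /\ dir_II a c b d = t.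

Definition in_GFR (a c : K) : Prop :=
  repelling a c \/ exists t1 t2, t1 != t2 /\ FRdir a c t1 /\ FRdir a c t2.

Definition valence (a c : K) : nat :=
  match excluded_middle_informative (in_GFR a c) with
  | left _ => fin_card (FRdir a c)
  | right _ => 0%N
  end.

Definition weight (a c : K) : int :=
  match excluded_middle_informative (fixedII a c) with
  | left _ => ((rdeg (phi_red a c)).-1 + Nmoved a c)%:Z
  | right _ =>
    match excluded_middle_informative (branch_GFix a c) with
    | left _ => (valence a c)%:Z - 2
    | right _ => 0
    end
  end.

Definition W1 (a c : K) : Prop := fixedII a c /\ (2 <= rdeg (phi_red a c))%N.
Definition W2 (a c : K) : Prop :=
  fixedII a c /\
  (exists2 ct : k, (ct != 0) && (ct != 1) & conj_k (phi_red a c) (ct *: 'X, 1)) /\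
  branch_GFix a c.
Definition W3 (a c : K) : Prop :=
  fixedII a c /\
  (exists2 at_ : k, at_ != 0 & conj_k (phi_red a c) ('X + at_%:P, 1)) /\
  in_GFix a c.
Definition W4 (a c : K) : Prop := ~ fixedII a c /\ branch_GFix a c.

End Defs.

(* fixed points with multiplicity: the roots in P^1(K) of X G(X,Y) - Y F(X,Y),
   i.e. finite ones are the roots of z q - p, infinity with multiplicity
   3 - deg(z q - p) (deg phi = 2). *)
Definition fixpt_list (K : fieldType) (p q : {poly K}) (xs : seq (option K)) : Prop :=
  size xs = 3%N /\
  exists2 c : K, c != 0 & 'X * q - p = c *: \prod_(x <- pmap id xs) ('X - x%:P).

(* multiplier of phi = p/q (degree 2) at a fixed point; at infinity computed in
   the chart w = 1/z, where phi becomes rev(q)/rev(p). *)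
Definition mult2 (K : fieldType) (p q : {poly K}) (x : option K) : K :=
  match x with
  | Some x => (p^`() * q - p * q^`()).[x] / (q.[x]) ^+ 2
  | None =>
    let rp := \poly_(i < 3) p`_(2 - i) in
    let rq := \poly_(i < 3) q`_(2 - i) in
    (rq^`() * rp - rq * rp^`()).[0] / (rp.[0]) ^+ 2
  end.

Definition spec3 (K : fieldType) (R : realType) (v : nonarch_abs K R) (k : fieldType)
  (rd : residue_map v k) (x y z : K) : k * k * k :=
  let u := maxcoef v [:: x; y; z] in (rd (x / u), rd (y / u), rd (z / u)).

Definition proj_eq (k : fieldType) (s t : k * k * k) : Prop :=
  exists2 c : k, c != 0 & s = (c * t.1.1, c * t.1.2, c * t.2).

(* Main.v *)
Require Import Defs.
From HB Require Import structures.
From mathcomp Require Import all_boot all_order all_algebra.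
From mathcomp Require Import reals.
From mathcomp Require Import ring.
From Stdlib Require Import ClassicalEpsilon.
Set Implicit Arguments. Unset Strict Implicit. Unset Printing Implicit Defensive.
Import Order.TTheory GRing.Theory Num.Theory.
Local Open Scope ring_scope.

(* Let [F : G] be a lift of phi.  At a fixed point t the lift multiplies a
   representative of t by some mu(t), and Euler's formula gives
   lambda = tau(t) / mu(t), with tau(t) polynomial in the lift.  Writing the
   lift in terms of its fixed points yields C mu1 mu2 mu3 = Res(F, G) and
   forms S1, S2 of degree 4 in the coefficients with sigma_i Res = S_i.  All
   three forms are multiplied by the same constant when phi is conjugated or
   the lift is rescaled, so, in the coordinate at a type II point P and with a
   normalized lift, [sigma_1 : sigma_2 : 1] reduces to [S1 : S2 : Res] computed
   over the residue field, provided these do not all vanish there.  It remains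
   to evaluate them on the reduced lift, which is d (A, B) with d the common
   factor.  If deg (A : B) = 2 then Res <> 0.  If deg (A : B) = 1, positive
   weight says that the root of d is moved by (A : B); then S1 <> 0 and
   S2 / S1 = mu1 / mu2 + mu2 / mu1 for the eigenvalues mu1, mu2 of (A : B).
   If (A : B) is constant then Res = S1 = 0, and S2 is minus the discriminant of the
   reduced fixed-point form, nonzero exactly at a branch point. *)

(** * Multipliers and the resultant *)

(** The resultant of two binary quadratic forms, as a Bezout determinant. Degree two is built in, so
    a common zero at infinity also makes it vanish. *)
Definition res2 (A : comNzRingType) (f g : {poly A}) : A :=
  (f`_2 * g`_0 - f`_0 * g`_2) ^+ 2
  - (f`_2 * g`_1 - f`_1 * g`_2) * (f`_1 * g`_0 - f`_0 * g`_1).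

(* Obtained by expanding [C * \sum_i tau_i * mu_j * mu_k] (see [sig1_mu]) in the
   coefficients. *)
Definition sig1 (A : comNzRingType) (f g : {poly A}) : A :=
  let: (a0, a1, a2) := (f`_0, f`_1, f`_2) in
  let: (b0, b1, b2) := (g`_0, g`_1, g`_2) in
  - 6 * a0 ^+ 2 * b2 ^+ 2 - 4 * a0 * a1 * a2 * b2 + 4 * a0 * a1 * b1 * b2
  + 4 * a0 * a2 ^+ 2 * b1 + 4 * a0 * a2 * b0 * b2 - 2 * a0 * a2 * b1 ^+ 2
  - 4 * a0 * b0 * b1 * b2 + a0 * b1 ^+ 3 + a1 ^+ 3 * b2 - a1 ^+ 2 * a2 * b1
  - 2 * a1 ^+ 2 * b0 * b2 + 4 * a1 * b0 ^+ 2 * b2 - a1 * b0 * b1 ^+ 2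
  + 2 * a2 ^+ 2 * b0 ^+ 2.

(** The discriminant of the binary cubic [X G - Y F], whose zeros on the projective line are the
    fixed points; [e3, ..., e0] are its coefficients. *)
Definition disc_fix (A : comNzRingType) (f g : {poly A}) : A :=
  let: (e3, e2, e1, e0) := (g`_2, g`_1 - f`_2, g`_0 - f`_1, - f`_0) in
  e2 ^+ 2 * e1 ^+ 2 - 4 * e3 * e1 ^+ 3 - 4 * e2 ^+ 3 * e0
  - 27 * e3 ^+ 2 * e0 ^+ 2 + 18 * e3 * e2 * e1 * e0.

(* Since sigma_3 = sigma_1 - 2, the product of the [1 - lambda_i] is
   [3 - 2 sigma_1 + sigma_2]; it is also minus the discriminant of the
   fixed-point form divided by the resultant. *)
Definition sig2 (A : comNzRingType) (f g : {poly A}) : A :=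
  2 * sig1 f g - 3 * res2 f g - disc_fix f g.

(* Infinity gets the coordinates (-1 : 0), so that the linear form
   [py t * X - px t * Y] vanishing at [t] is monic. *)
Definition px (A : nzRingType) (t : option A) : A := if t is Some x then x else -1.
Definition py (A : nzRingType) (t : option A) : A := if t is Some _ then 1 else 0.

(** This is [X G - Y F = C * \prod (y_i X - x_i Y)], read coefficientwise. Arbitrary homogeneous
    coordinates are allowed because conjugation rescales them, and [C] may be zero, as can happen
    after reduction. *)
Definition factors (A : comNzRingType) (f g : {poly A}) (C x1 y1 x2 y2 x3 y3 : A) :=
  [/\ g`_2 = C * (y1 * y2 * y3),
      g`_1 - f`_2 = - C * (x1 * y2 * y3 + y1 * x2 * y3 + y1 * y2 * x3),
      g`_0 - f`_1 = C * (x1 * x2 * y3 + x1 * y2 * x3 + y1 * x2 * x3)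
    & f`_0 = C * (x1 * x2 * x3)].

Definition fix_factors (A : comNzRingType) (f g : {poly A}) (C : A) (t1 t2 t3 : option A) :=
  factors f g C (px t1) (py t1) (px t2) (py t2) (px t3) (py t3).

Definition hval (A : comNzRingType) (f : {poly A}) (x y : A) : A :=
  f`_2 * x ^+ 2 + f`_1 * x * y + f`_0 * y ^+ 2.

(* At a fixed point the lift [(f, g)] multiplies [(px t, py t)] by [mu f g t]
   (and [hval] takes values [mu * px], [mu * py]). *)
Definition mu (A : comNzRingType) (f g : {poly A}) (t : option A) : A :=
  if t is Some x then hval g x 1 else - f`_2.

(* By Euler's formula the differential of the lift at a fixed point has
   eigenvalues [2 mu] and [lambda * mu], so its trace determines [lambda * mu]. *)
Definition tau (A : comNzRingType) (f g : {poly A}) (t : option A) : A :=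
  (2 * f`_2 + g`_1) * px t + (f`_1 + 2 * g`_0) * py t - 2 * mu f g t.

Lemma fix_factors_elim (A : comNzRingType) (f g : {poly A}) C x1 y1 x2 y2 x3 y3 :
  factors f g C x1 y1 x2 y2 x3 y3 ->
  [/\ g`_2 = C * (y1 * y2 * y3),
      g`_1 = f`_2 - C * (x1 * y2 * y3 + y1 * x2 * y3 + y1 * y2 * x3),
      g`_0 = f`_1 + C * (x1 * x2 * y3 + x1 * y2 * x3 + y1 * x2 * x3)
    & f`_0 = C * (x1 * x2 * x3)].
Proof.
case=> e3 e2 e1 e0; split=> //.
  by rewrite -[LHS](subrK f`_2) e2; ring.
by rewrite -[LHS](subrK f`_1) e1; ring.
Qed.

(** Generically, [C^2 * \prod (y_i mu_i)] and [g_2 Res(F, G)] are both, up to sign, the resultant of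
    [X G - Y F] and [G]; cancelling [g_2 = C y1 y2 y3] leaves this formula. *)
Lemma res2_mu (A : comNzRingType) (f g : {poly A}) C t1 t2 t3 :
  fix_factors f g C t1 t2 t3 ->
  res2 f g = C * (mu f g t1 * mu f g t2 * mu f g t3).
Proof.
move=> /fix_factors_elim[]; rewrite /res2 /mu /hval.
by case: t1 t2 t3 => [x1|] [x2|] [x3|] /= -> -> -> ->; ring.
Qed.

Lemma sig1_mu (A : comNzRingType) (f g : {poly A}) C t1 t2 t3 :
  fix_factors f g C t1 t2 t3 ->
  sig1 f g = C * (tau f g t1 * mu f g t2 * mu f g t3
    + mu f g t1 * tau f g t2 * mu f g t3 + mu f g t1 * mu f g t2 * tau f g t3).
Proof.
move=> /fix_factors_elim[]; rewrite /sig1 /tau /mu /hval.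
by case: t1 t2 t3 => [x1|] [x2|] [x3|] /= -> -> -> ->; ring.
Qed.

Lemma disc_fixE (A : comNzRingType) (f g : {poly A}) C x1 y1 x2 y2 x3 y3 :
  factors f g C x1 y1 x2 y2 x3 y3 ->
  disc_fix f g =
    C ^+ 4 * ((x1 * y2 - x2 * y1) * (x1 * y3 - x3 * y1) * (x2 * y3 - x3 * y2)) ^+ 2.
Proof. by case; rewrite /disc_fix => -> -> -> ->; ring. Qed.

Lemma sig2_mu (A : comNzRingType) (f g : {poly A}) C t1 t2 t3 :
  fix_factors f g C t1 t2 t3 ->
  sig2 f g = C * (tau f g t1 * tau f g t2 * mu f g t3
    + tau f g t1 * mu f g t2 * tau f g t3 + mu f g t1 * tau f g t2 * tau f g t3).
Proof.
move=> ff; rewrite /sig2 (disc_fixE ff); case/fix_factors_elim: ff.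
rewrite /sig1 /res2 /tau /mu /hval.
by case: t1 t2 t3 => [x1|] [x2|] [x3|] /= -> -> -> ->; ring.
Qed.

Lemma fix_mu (A : comNzRingType) (f g : {poly A}) C t1 t2 t3 t :
  fix_factors f g C t1 t2 t3 -> t \in [:: t1; t2; t3] ->
  hval f (px t) (py t) = mu f g t * px t /\ hval g (px t) (py t) = mu f g t * py t.
Proof.
move=> /fix_factors_elim[]; rewrite /mu /hval !inE => e3 e2 e1 e0.
by case/or3P => /eqP ->; move: e3 e2 e1 e0;
  case: t1 t2 t3 => [x1|] [x2|] [x3|] /= -> -> -> ->; split; ring.
Qed.

Lemma poly3E (A : nzRingType) (f : {poly A}) (x : A) : (size f <= 3)%N ->
  f.[x] = f`_0 + f`_1 * x + f`_2 * x ^+ 2.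
Proof.
by move=> sf; rewrite (horner_coef_wide _ sf) !big_ord_recr big_ord0 /= add0r expr0 expr1 mulr1.
Qed.

(** If [mu] vanished, the point would be a common zero of the two forms. A finite one contradicts
    coprimality; one at infinity would lower the degree. *)
Lemma mu_neq0 (A : fieldType) (f g : {poly A}) C t1 t2 t3 t :
  fix_factors f g C t1 t2 t3 -> t \in [:: t1; t2; t3] ->
  coprimep f g -> maxn (size f) (size g) = 3%N -> mu f g t != 0.
Proof.
move=> ff tin cop sz; have [ef eg] := fix_mu ff tin.
have sf : (size f <= 3)%N by rewrite -sz leq_maxl.
have sg : (size g <= 3)%N by rewrite -sz leq_maxr.
apply/eqP=> mu0; move: ef eg; rewrite mu0 !mul0r /hval => ef eg.
case: t tin mu0 ef eg => [x|] /= tin mu0 ef eg.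
  have fx : root f x by rewrite /root poly3E // -[X in _ == X]ef; apply/eqP; ring.
  have := coprimep_root cop fx.
  by rewrite poly3E // -[X in _ != X]eg => /eqP; apply; ring.
have f2 : f`_2 = 0 by rewrite -[RHS]ef; ring.
have g2 : g`_2 = 0 by rewrite -[RHS]eg; ring.
have small (h : {poly A}) : (size h <= 3)%N -> h`_2 = 0 -> (size h <= 2)%N.
  move=> sh h2; apply/leq_sizeP => j; rewrite leq_eqVlt => /orP[/eqP<-//|lj].
  by rewrite nth_default // (leq_trans sh lj).
have : (maxn (size f) (size g) <= 2)%N by rewrite geq_max !small.
by rewrite sz.
Qed.

Definition pcoefE := (coefD, coefB, coefN, coefZ, coefMX, coefXM, coefC, coefX).

(** [pmap id] drops infinity from the product. This agrees with the form [Y] attached to infinity by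
    [px] and [py], which dehomogenizes to 1. *)
Lemma fixpt_list_factors (K : fieldType) (p q : {poly K}) t1 t2 t3 :
  fixpt_list p q [:: t1; t2; t3] ->
  (size p <= 3)%N -> exists2 C, C != 0 & fix_factors p q C t1 t2 t3.
Proof.
case=> _ [C C0 e] sp; exists C => //.
have ei i : ('X * q - p)`_i = C * (\prod_(x <- pmap id [:: t1; t2; t3]) ('X - x%:P))`_i.
  by rewrite e coefZ.
have p3 : p`_3 = 0 by rewrite nth_default.
have q2 : q`_2 = ('X * q - p)`_3 by rewrite !pcoefE /= p3 subr0.
have q1 : q`_1 - p`_2 = ('X * q - p)`_2 by rewrite !pcoefE.
have q0 : q`_0 - p`_1 = ('X * q - p)`_1 by rewrite !pcoefE.
have p0 : p`_0 = - ('X * q - p)`_0 by rewrite !pcoefE /= sub0r opprK.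
rewrite /fix_factors; split; [rewrite q2|rewrite q1|rewrite q0|rewrite p0];
  rewrite ei {e ei q2 q1 q0 p0 p3}; case: t1 t2 t3 => [x1|] [x2|] [x3|] /=;
  rewrite ?(big_cons, big_nil) ?mulr1 ?mulrBl ?mulrBr ?mul_polyC -?polyCM;
  by rewrite !pcoefE ?coef1 /=; ring.
Qed.

Lemma deriv3E (A : comNzRingType) (f : {poly A}) (x : A) : (size f <= 3)%N ->
  f^`().[x] = f`_1 + 2 * f`_2 * x.
Proof.
move=> sf; rewrite (@horner_coef_wide _ 2); last first.
  by rewrite (leq_trans (size_poly _ _)) //; case: (size f) sf => // n; apply.
by rewrite !big_ord_recr big_ord0 /= !coef_deriv expr0 expr1; ring.
Qed.

(** At a finite fixed point [p = mu x] and [q = mu], so the quotient rule gives [(p' - x q') / mu],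
    whose numerator is [tau]. At infinity the leading coefficient of [q] vanishes and the chart
    [1/z] is expanded at 0. *)
Lemma mult2_mu (K : fieldType) (p q : {poly K}) C t1 t2 t3 t :
  fix_factors p q C t1 t2 t3 -> t \in [:: t1; t2; t3] ->
  (size p <= 3)%N -> (size q <= 3)%N -> mu p q t != 0 ->
  mult2 p q t = tau p q t / mu p q t.
Proof.
move=> ff tin sp sq; have [ep eq_] := fix_mu ff tin.
case: t tin ep eq_ => [x|] /= tin ep eq_ mu0.
  have px : p.[x] = hval q x 1 * x.
    by rewrite poly3E //; move: ep; rewrite {1}/hval => <-; ring.
  have qx : q.[x] = hval q x 1 by rewrite poly3E // /hval; ring.
  rewrite hornerD hornerN !hornerM px qx !deriv3E // /tau /=.
  by move: mu0; rewrite /hval => mu0; field; move: mu0; congr (_ != 0); ring.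
have q2 : q`_2 = 0 by rewrite -[RHS](mulr0 (- p`_2)) -eq_ /hval; ring.
rewrite !horner_coef0 !coefB !coefM !big_ord_recr !big_ord0 /=.
rewrite !coef_deriv !coef_poly /= /tau /= q2.
by rewrite ?(subn0, subnn, subn1) /=; field; rewrite mu0 -oppr_eq0.
Qed.

Lemma sigmas_mult (K : fieldType) (p q : {poly K}) C t1 t2 t3 :
  fix_factors p q C t1 t2 t3 -> coprimep p q -> maxn (size p) (size q) = 3%N ->
  let: (l1, l2, l3) := (mult2 p q t1, mult2 p q t2, mult2 p q t3) in
  (l1 + l2 + l3) * res2 p q = sig1 p q /\
  (l1 * l2 + l1 * l3 + l2 * l3) * res2 p q = sig2 p q.
Proof.
move=> ff cop sz.
have sp : (size p <= 3)%N by rewrite -sz leq_maxl.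
have sq : (size q <= 3)%N by rewrite -sz leq_maxr.
have m0 t : t \in [:: t1; t2; t3] -> mu p q t != 0 by move=> ?; apply: (mu_neq0 ff).
have lE t : t \in [:: t1; t2; t3] -> mult2 p q t = tau p q t / mu p q t.
  by move=> tin; apply: (mult2_mu ff) => //; apply: m0.
rewrite (sig1_mu ff) (sig2_mu ff) (res2_mu ff) !lE ?inE ?eqxx ?orbT //.
by split; field; rewrite !m0 ?inE ?eqxx ?orbT.
Qed.

(** * Conjugation by affine maps *)

Section Conjugation.
Variables (K : fieldType) (p q : {poly K}) (a c : K).
Hypotheses (sp : (size p <= 3)%N) (sq : (size q <= 3)%N).

Lemma comp_affineE (f : {poly K}) : (size f <= 3)%N ->
  f \Po (c *: 'X + a%:P) =
    (f`_2 * c ^+ 2) *: 'X^2 + (2 * a * c * f`_2 + c * f`_1) *: 'X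
    + (f`_0 + f`_1 * a + f`_2 * a ^+ 2)%:P.
Proof.
move=> sf; rewrite {1}(_ : f = \poly_(i < 3) f`_i); last first.
  apply/polyP => i; rewrite coef_poly; case: ltnP => // li.
  by rewrite nth_default // (leq_trans sf).
rewrite poly_def !big_ord_recr big_ord0 /= add0r !linearD /= !linearZ /=.
rewrite expr0 expr1 expr2 comp_polyM comp_polyX -polyC1 comp_polyC -!mul_polyC.
rewrite !(polyCM, polyCD); ring.
Qed.

Let P := (phi_conj p q a c).1.
Let Q := (phi_conj p q a c).2.

Lemma phi_conj_coef :
  [/\ (size P <= 3)%N, (size Q <= 3)%N &
  [/\ P`_0 = p`_0 + p`_1 * a + p`_2 * a ^+ 2 - a * (q`_0 + q`_1 * a + q`_2 * a ^+ 2),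
      P`_1 = 2 * a * c * p`_2 + c * p`_1 - a * (2 * a * c * q`_2 + c * q`_1)
    & P`_2 = p`_2 * c ^+ 2 - a * (q`_2 * c ^+ 2)] /\
  [/\ Q`_0 = c * (q`_0 + q`_1 * a + q`_2 * a ^+ 2),
      Q`_1 = c * (2 * a * c * q`_2 + c * q`_1)
    & Q`_2 = c * (q`_2 * c ^+ 2)]].
Proof.
have s3 (u0 u1 u2 : K) : (size (u2 *: 'X^2 + u1 *: 'X + u0%:P)%R <= 3)%N.
  apply/leq_sizeP => -[|[|[|j]]] // _.
  by rewrite !coefD !coefZ coefXn coefX coefC /= !mulr0 !addr0.
rewrite /P /Q /phi_conj /= !comp_affineE //; split.
- rewrite (leq_trans (size_polyD _ _)) // geq_max s3 size_polyN.
  by rewrite (leq_trans (size_scale_leq _ _)).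
- by rewrite (leq_trans (size_scale_leq _ _)).
split; split; rewrite !(coefD, coefN, coefZ, coefXn, coefX, coefC) /=; ring.
Qed.

Variable u : K.
Let F := u *: P.
Let G := u *: Q.
Let FE i : F`_i = u * P`_i. Proof. exact: coefZ. Qed.
Let GE i : G`_i = u * Q`_i. Proof. exact: coefZ. Qed.

(** All three forms have degree 4 in the coefficients, whence [u ^+ 4]. For the resultant,
    substituting a map of determinant [c] contributes [c ^+ 4] and applying its adjugate [c ^+ 2];
    the other two follow because multipliers are conjugation invariant. *)
Lemma conj_invariants :
  [/\ res2 F G = u ^+ 4 * c ^+ 6 * res2 p q,
      sig1 F G = u ^+ 4 * c ^+ 6 * sig1 p q
    & sig2 F G = u ^+ 4 * c ^+ 6 * sig2 p q].
Proof.
have [_ _ [[P0 P1 P2] [Q0 Q1 Q2]]] := phi_conj_coef.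
by split; rewrite /sig2 /sig1 /res2 /disc_fix !FE !GE P0 P1 P2 Q0 Q1 Q2; ring.
Qed.

(** The inverse of [z -> a + c z] sends [(x : y)] to [(x - a y : c y)]. The scalars [w1, w2, w3]
    stay free so that each pair can later be made primitive. *)
Lemma conj_factors C t1 t2 t3 w1 w2 w3 :
  w1 != 0 -> w2 != 0 -> w3 != 0 ->
  fix_factors p q C t1 t2 t3 ->
  factors F G (u * C / (w1 * w2 * w3))
    (w1 * (px t1 - a * py t1)) (w1 * (c * py t1))
    (w2 * (px t2 - a * py t2)) (w2 * (c * py t2))
    (w3 * (px t3 - a * py t3)) (w3 * (c * py t3)).
Proof.
move=> w10 w20 w30 /fix_factors_elim[e2 e1 e0 f0].
have [_ _ [[P0 P1 P2] [Q0 Q1 Q2]]] := phi_conj_coef.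
by split; rewrite ?FE ?GE ?P0 ?P1 ?P2 ?Q0 ?Q1 ?Q2 ?e2 ?e1 ?e0 ?f0;
  field; rewrite w10 w20 w30.
Qed.

(** The multiplier is unchanged while the eigenvalue of the lift is rescaled to [m]. The last
    relation avoids division so that it can be reduced term by term. *)
Lemma conj_multiplier C t1 t2 t3 t w (m := u * w * c ^+ 2 * mu p q t)
    (x := w * (px t - a * py t)) (y := w * (c * py t)) :
  fix_factors p q C t1 t2 t3 -> t \in [:: t1; t2; t3] -> mu p q t != 0 ->
  [/\ hval F x y = m * x, hval G x y = m * y &
   mult2 p q t * m = (2 * F`_2 + G`_1) * x + (F`_1 + 2 * G`_0) * y - 2 * m].
Proof.
move=> ff tin m0; have [ep eq_] := fix_mu ff tin.
have [_ _ [[P0 P1 P2] [Q0 Q1 Q2]]] := phi_conj_coef.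
rewrite (mult2_mu ff) // /m.
rewrite [_ / _ * _](_ : _ = u * w * c ^+ 2 * tau p q t); last by field.
have eP : hval F x y = u * w ^+ 2 * c ^+ 2 *
    (hval p (px t) (py t) - a * hval q (px t) (py t)).
  by rewrite /hval !FE P0 P1 P2 /x /y; ring.
have eQ : hval G x y = u * w ^+ 2 * c ^+ 3 * hval q (px t) (py t).
  by rewrite /hval !GE Q0 Q1 Q2 /x /y; ring.
split.
- by rewrite eP ep eq_ /x; ring.
- by rewrite eQ eq_ /y; ring.
- by rewrite !FE !GE P1 P2 Q0 Q1 /x /y /tau; ring.
Qed.

End Conjugation.

(** * Reduction *)

Section Reduction.
Variables (R : realType) (K : fieldType) (v : nonarch_abs K R) (k : fieldType).
Variable (rd : residue_map v k).

Lemma nabs0 : v 0 = 0.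
Proof. by apply/eqP; rewrite nabs_eq0. Qed.

Lemma nabs1 : v 1 = 1.
Proof.
have /eqP := nabsM v 1 1; rewrite mulr1 -subr_eq0 -{1}[v 1]mulr1 -mulrBr mulf_eq0.
by rewrite nabs_eq0 oner_eq0 subr_eq0 => /eqP ->.
Qed.

Lemma nabsN x : v (- x) = v x.
Proof.
rewrite -mulN1r nabsM; suff -> : v (-1) = 1 by rewrite mul1r.
apply/eqP; rewrite -(@eqrXn2 _ 2) ?nabs_ge0 //.
by rewrite expr2 -nabsM mulrNN mulr1 nabs1 expr1n.
Qed.

Lemma nabs_gt0 x : x != 0 -> 0 < v x.
Proof. by rewrite lt_def nabs_eq0 nabs_ge0 andbT. Qed.

Lemma nabsV x : v x^-1 = (v x)^-1.
Proof.
have [->|x0] := eqVneq x 0; first by rewrite invr0 nabs0 invr0.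
apply: (mulfI (lt0r_neq0 (nabs_gt0 x0))).
by rewrite -nabsM divff // nabs1 divff // lt0r_neq0 ?nabs_gt0.
Qed.

Lemma nabs_div_le1 x y : v x <= v y -> v (x / y) <= 1.
Proof.
have [->|y0] := eqVneq y 0; first by rewrite invr0 mulr0 nabs0.
by rewrite nabsM nabsV ler_pdivrMr ?nabs_gt0 // mul1r.
Qed.

(** Integrality travels with the residue because [rd] is only assumed to respect sums and products
    on the valuation ring. *)
Definition reduces (x : K) (t : k) : Prop := v x <= 1 /\ rd x = t.

Lemma reduces_rd x : v x <= 1 -> reduces x (rd x). Proof. by []. Qed.

Lemma reduces0P x : v x <= 1 -> reduces x 0 <-> v x < 1.
Proof.
move=> vx; rewrite -(red_eq0 rd vx).
by split=> [[_ ->]|/eqP] //; split.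
Qed.

Lemma reduces0 : reduces 0 0.
Proof. by apply/reduces0P; rewrite nabs0 ?ler01 ?ltr01. Qed.

Lemma reduces1 : reduces 1 1.
Proof. by split; rewrite ?nabs1 ?red1. Qed.

Lemma reducesD x y s t : reduces x s -> reduces y t -> reduces (x + y) (s + t).
Proof.
move=> [vx <-] [vy <-]; split; last exact: redD.
by rewrite (le_trans (nabs_ultra v x y)) // ge_max vx.
Qed.

Lemma reducesM x y s t : reduces x s -> reduces y t -> reduces (x * y) (s * t).
Proof.
by move=> [vx <-] [vy <-]; split; [rewrite nabsM mulr_ile1 ?nabs_ge0|exact: redM].
Qed.

Lemma reducesN x s : reduces x s -> reduces (- x) (- s).
Proof.
move=> [vx <-]; split; first by rewrite nabsN.
apply/eqP; rewrite -subr_eq0 opprK -redD ?nabsN // addNr.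
by case: reduces0 => _ ->.
Qed.

Lemma reduces_nat n : reduces n%:R n%:R.
Proof.
elim: n => [|n IH]; first exact: reduces0.
by rewrite -addn1 !natrD; apply: reducesD reduces1.
Qed.

Lemma reducesX x s n : reduces x s -> reduces (x ^+ n) (s ^+ n).
Proof.
by move=> xs; elim: n => [|n IH]; rewrite ?exprS; [exact: reduces1|exact: reducesM].
Qed.

Lemma reduces_unit x t : reduces x t -> t != 0 -> v x = 1.
Proof.
move=> [vx <-]; rewrite (red_eq0 rd vx) -leNgt => v1.
by apply/eqP; rewrite eq_le vx.
Qed.

Lemma reduces_div x y s t :
  reduces (x * y) s -> reduces y t -> t != 0 -> reduces x (s / t).
Proof.
move=> [vxy exy] yt t0; have vy := reduces_unit yt t0.
have vx : v x <= 1 by move: vxy; rewrite nabsM vy mulr1.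
split=> //; apply: (mulIf t0); rewrite divfK // -exy.
by case: yt => vy1 <-; rewrite redM.
Qed.

Ltac reduce := repeat lazymatch goal with
  | |- reduces (_ + _) _ => apply: reducesD
  | |- reduces (- _) _ => apply: reducesN
  | |- reduces (_ ^+ _) _ => apply: reducesX
  | |- reduces (_ * _) _ => apply: reducesM
  | |- reduces (_%:R) _ => exact: reduces_nat
  | |- reduces 1 _ => exact: reduces1
  | |- reduces 0 _ => exact: reduces0
  | |- _ => assumption
  end.

Variables (F G : {poly K}) (f g : {poly k}).
Hypotheses (Ff : forall i, reduces F`_i f`_i) (Gg : forall i, reduces G`_i g`_i).

Lemma reduces_invariants :
  [/\ reduces (res2 F G) (res2 f g), reduces (sig1 F G) (sig1 f g)
    & reduces (sig2 F G) (sig2 f g)].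
Proof.
have [F0 F1 F2] := And3 (Ff 0) (Ff 1) (Ff 2).
have [G0 G1 G2] := And3 (Gg 0) (Gg 1) (Gg 2).
by split; rewrite /sig2 /res2 /sig1 /disc_fix; reduce.
Qed.

(** The reduced linear forms are nonzero, so Gauss's lemma makes [C] integral and the factorization
    reduces. The residue [c] is zero when the reduced fixed-point form vanishes identically. *)
Lemma reduces_factors C x1 y1 x2 y2 x3 y3 t1 t2 t3 :
  factors F G C x1 y1 x2 y2 x3 y3 ->
  reduces x1 (px t1) -> reduces y1 (py t1) ->
  reduces x2 (px t2) -> reduces y2 (py t2) ->
  reduces x3 (px t3) -> reduces y3 (py t3) ->
  exists c, fix_factors f g c t1 t2 t3.
Proof.
move=> [e3 e2 e1 e0] X1 Y1 X2 Y2 X3 Y3.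
have [F0 F1 F2] := And3 (Ff 0) (Ff 1) (Ff 2).
have [G0 G1 G2] := And3 (Gg 0) (Gg 1) (Gg 2).
have uniq_red x s t : reduces x s -> reduces x t -> s = t by case=> _ <- [_ <-].
have [vC|vC] := leP (v C) 1; last first.
  (* Gauss: dividing by [C], the product of three nonzero reduced forms would be 0. *)
  have C0 : C != 0 by rewrite -(nabs_eq0 v) gt_eqF // (lt_trans ltr01).
  have CV : reduces C^-1 0.
    have VC : v C^-1 < 1 by rewrite nabsV invf_lt1 // (lt_trans ltr01).
    by apply/reduces0P => //; apply: ltW.
  have r3 : 0 * g`_2 = py t1 * py t2 * py t3.
    apply: (uniq_red (C^-1 * G`_2)); first by reduce.
    by rewrite e3 mulKf //; reduce.
  have r2 : 0 * (g`_1 - f`_2) =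
      - (px t1 * py t2 * py t3 + py t1 * px t2 * py t3 + py t1 * py t2 * px t3).
    apply: (uniq_red (C^-1 * (G`_1 - F`_2))); first by reduce.
    by rewrite e2 mulNr mulrN mulKf //; reduce.
  have r1 : 0 * (g`_0 - f`_1) =
      px t1 * px t2 * py t3 + px t1 * py t2 * px t3 + py t1 * px t2 * px t3.
    apply: (uniq_red (C^-1 * (G`_0 - F`_1))); first by reduce.
    by rewrite e1 mulKf //; reduce.
  have r0 : 0 * f`_0 = px t1 * px t2 * px t3.
    apply: (uniq_red (C^-1 * F`_0)); first by reduce.
    by rewrite e0 mulKf //; reduce.
  have := oner_neq0 k; move: r3 r2 r1 r0; rewrite !mul0r => r3 r2 r1 r0.
  (* The product of monic forms is monic: with [n] points at infinity its coefficient of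
     [X^(3-n) Y^n] is 1, so one of the four equations reads [1 = 0]. The sign is adjusted for
     [n = 3]. *)
  have r0' : 0 = - (px t1 * px t2 * px t3) by rewrite -r0 oppr0.
  by move: r3 r2 r1 r0'; case: t1 t2 t3 {X1 Y1 X2 Y2 X3 Y3 r0} => [x|] [y|] [z|] /=
    r3 r2 r1 r0 /eqP[];
    first [by apply: etrans (esym r3); ring | by apply: etrans (esym r2); ring
          | by apply: etrans (esym r1); ring | by apply: etrans (esym r0); ring].
exists (rd C); have Cc := reduces_rd vC.
split.
- by apply: (uniq_red G`_2) => //; rewrite e3; reduce.
- by apply: (uniq_red (G`_1 - F`_2)); first reduce; rewrite e2; reduce.
- by apply: (uniq_red (G`_0 - F`_1)); first reduce; rewrite e1; reduce.
- by apply: (uniq_red F`_0) => //; rewrite e0; reduce.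
Qed.

(** One coordinate of [t] is 1 or -1, so dividing by its lift shows that [m] is integral with
    residue [mu]. As this residue is nonzero, [m] is a unit and can be divided out. *)
Lemma reduces_multiplier x y m l t :
  reduces x (px t) -> reduces y (py t) ->
  hval F x y = m * x -> hval G x y = m * y ->
  l * m = (2 * F`_2 + G`_1) * x + (F`_1 + 2 * G`_0) * y - 2 * m ->
  mu f g t != 0 -> reduces l (tau f g t / mu f g t).
Proof.
move=> xt yt eF eG em m0.
have [F0 F1 F2] := And3 (Ff 0) (Ff 1) (Ff 2).
have [G0 G1 G2] := And3 (Gg 0) (Gg 1) (Gg 2).
have rm : reduces m (mu f g t).
  case: t xt yt {m0} => [s|] /= xt yt.
    rewrite -[hval g s 1]divr1; apply: (reduces_div _ yt (oner_neq0 _)).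
    by rewrite -eG /hval /=; reduce.
  have n1 : -1 != 0 :> k by rewrite oppr_eq0 oner_neq0.
  have -> : - f`_2 = hval f (-1) 0 / -1 by rewrite /hval; field.
  by apply: (reduces_div _ xt n1); rewrite -eF /hval; reduce.
by apply: (reduces_div _ rm m0); rewrite em /tau; reduce.
Qed.

End Reduction.

(** * Normalized lifts, directions and specialization *)

Section Normalization.
Variables (R : realType) (K : fieldType) (v : nonarch_abs K R) (k : fieldType).
Variable (rd : residue_map v k).

Lemma maxcoefP (s : seq K) :
  maxcoef v s \in 0 :: s /\ forall x, x \in s -> v x <= v (maxcoef v s).
Proof.
elim: s => [|x s [IH1 IH2]] /=; first by rewrite inE eqxx.
case: ltP => vx; split.
- by rewrite !inE eqxx orbT.
- by move=> y; rewrite inE => /orP[/eqP->//|/IH2 /le_trans]; apply; apply: ltW.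
- by move: IH1; rewrite !inE => /orP[->//|->]; rewrite !orbT.
- by move=> y; rewrite inE => /orP[/eqP->//|/IH2].
Qed.

Lemma nabs_coef_maxcoef (P : {poly K}) (s : seq K) i :
  {subset polyseq P <= s} -> v P`_i <= v (maxcoef v s).
Proof.
move=> sPs; have [_ le] := maxcoefP s.
have [lt|ge] := ltnP i (size P); first by apply/le/sPs/mem_nth.
by rewrite nth_default // nabs0 nabs_ge0.
Qed.

Lemma red_pairP (P Q : {poly K}) (u := maxcoef v (P ++ Q)) :
  (P != 0) || (Q != 0) ->
  [/\ u != 0,
      forall i, reduces rd (u^-1 *: P)`_i (red_pair rd (P, Q)).1`_i,
      forall i, reduces rd (u^-1 *: Q)`_i (red_pair rd (P, Q)).2`_i
    & ((red_pair rd (P, Q)).1 != 0) || ((red_pair rd (P, Q)).2 != 0)].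
Proof.
move=> PQ.
have leP i : v P`_i <= v u by apply: nabs_coef_maxcoef => x xP; rewrite mem_cat xP.
have leQ i : v Q`_i <= v u.
  by apply: nabs_coef_maxcoef => x xP; rewrite mem_cat xP orbT.
have u0 : u != 0.
  rewrite -(nabs_eq0 v) gt_eqF //.
  by case/orP: PQ => h; [apply: lt_le_trans (leP (size P).-1)
    | apply: lt_le_trans (leQ (size Q).-1)];
    apply: nabs_gt0; rewrite -lead_coefE lead_coef_eq0.
have rd0 : rd 0 = 0 by case: (reduces0 rd).
have e1 i : (red_pair rd (P, Q)).1`_i = rd (P`_i / u).
  by rewrite /red_pair /= coef_map_id0 // mul0r.
have e2 i : (red_pair rd (P, Q)).2`_i = rd (Q`_i / u).
  by rewrite /red_pair /= coef_map_id0 // mul0r.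
split=> // [i|i|].
- by rewrite e1 coefZ mulrC; apply/reduces_rd/nabs_div_le1.
- by rewrite e2 coefZ mulrC; apply/reduces_rd/nabs_div_le1.
(* The maximum is attained, so some normalized coefficient is [u / u = 1] and has residue 1. *)
have [uin _] := maxcoefP (P ++ Q).
move: uin; rewrite -/u inE (negPf u0) /= mem_cat => /orP[] /(nthP 0)[i _ ei].
  apply/orP; left; apply/eqP=> z; 
    have := etrans (esym (e1 i)) (congr1 (fun h : {poly k} => h`_i) z).
    rewrite /= coef0 ei divff // red1.
  by move/eqP; rewrite oner_eq0.
apply/orP; right; apply/eqP=> z; 
    have := etrans (esym (e2 i)) (congr1 (fun h : {poly k} => h`_i) z).
    rewrite /= coef0 ei divff // red1.
by move/eqP; rewrite oner_eq0.
Qed.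

(** Inside the disc [c^-1] normalizes the second coordinate to 1; outside it [- (b - a)^-1]
    normalizes the first to -1 and the second becomes small. Infinity already has the right
    coordinates. *)
Lemma dir_coords (a c : K) (b : option K) : c != 0 ->
  exists w, [/\ w != 0, reduces rd (w * (px b - a * py b)) (px (dir_cl rd a c b))
    & reduces rd (w * (c * py b)) (py (dir_cl rd a c b))].
Proof.
move=> c0; case: b => [b|] /=; last first.
  exists 1; rewrite oner_neq0 !(mulr0, subr0, mul1r); split=> //.
    exact: reducesN (reduces1 _).
  exact: reduces0.
rewrite !mulr1; case: leP => vb /=.
  exists c^-1; rewrite invr_eq0 mulVf //; split=> //; last exact: reduces1.
  by rewrite mulrC; apply/reduces_rd/nabs_div_le1.
have ba0 : b - a != 0.
  by rewrite -(nabs_eq0 v) gt_eqF // (le_lt_trans (nabs_ge0 v c)).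
exists (- (b - a)^-1); rewrite oppr_eq0 invr_eq0 mulNr mulVf //; split=> //.
  exact: reducesN (reduces1 _).
rewrite -[X in reduces _ _ X]oppr0 mulNr; apply: reducesN.
rewrite mulrC; apply/reduces0P; first by apply: nabs_div_le1; apply: ltW.
by rewrite nabsM nabsV ltr_pdivrMr ?nabs_gt0 // mul1r.
Qed.

(** The vector [(V1, V2, r)] is primitive, since its reduction is nonzero, and it is proportional to
    [(s1, s2, 1)]. Two primitive multiples of one vector differ by a unit, here [w]. *)
Lemma spec3_proportional (s1 s2 r V1 V2 : K) (t1 t2 t3 : k) :
  r != 0 -> s1 * r = V1 -> s2 * r = V2 ->
  reduces rd V1 t1 -> reduces rd V2 t2 -> reduces rd r t3 ->
  [|| t1 != 0, t2 != 0 | t3 != 0] ->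
  exists2 e, e != 0 & spec3 rd s1 s2 1 = (e * t1, e * t2, e * t3).
Proof.
move=> r0 e1 e2 R1 R2 R3 nz; rewrite /spec3.
have [uin ule] := maxcoefP [:: s1; s2; 1]; set u := maxcoef v _ in uin ule *.
have u0 : u != 0.
  rewrite -(nabs_eq0 v) gt_eqF // (lt_le_trans _ (ule 1 _)) ?nabs1 //.
  by rewrite !inE eqxx !orbT.
pose w := (r * u)^-1.
have E1 : s1 / u = w * V1 by rewrite -e1 /w; field; rewrite r0 u0.
have E2 : s2 / u = w * V2 by rewrite -e2 /w; field; rewrite r0 u0.
have E3 : 1 / u = w * r by rewrite /w; field; rewrite r0 u0.
have L x : x \in [:: s1; s2; 1] -> v (x / u) <= 1 by move/ule/nabs_div_le1.
(* A coordinate with nonzero residue is a unit, and its product with [w] is integral. *)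
have vw1 : v w <= 1.
  have le V t x : x \in [:: s1; s2; 1] -> x / u = w * V -> reduces rd V t ->
      t != 0 -> v w <= 1.
    by move=> /L lx ex /reduces_unit h /h vV; move: lx; rewrite ex nabsM vV mulr1.
  by case/or3P: nz; [apply: (le V1 t1 s1)|apply: (le V2 t2 s2)|apply: (le r t3 1)];
    rewrite // !inE eqxx ?orbT.
(* The coordinate that equals [u] becomes 1 after division, so [w] times an integral element is
   1. *)
have vw2 : 1 <= v w.
  have ge V t x : u = x -> x / u = w * V -> reduces rd V t -> 1 <= v w.
    move=> <-; rewrite divff // => e [vV _]; rewrite -(nabs1 v) e nabsM.
    by rewrite ler_piMr ?nabs_ge0.
  move: uin; rewrite !inE (negPf u0) /= => /or3P[] /eqP eu.
  - exact: (ge V1 t1 s1).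
  - exact: (ge V2 t2 s2).
  - exact: (ge r t3 1).
exists (rd w); first by rewrite (red_eq0 rd vw1) -leNgt.
have W := reduces_rd rd vw1.
have [_ M1] := reducesM W R1; have [_ M2] := reducesM W R2.
by have [_ M3] := reducesM W R3; rewrite E1 E2 E3 M1 M2 M3.
Qed.

End Normalization.

(** * Maps over the residue field *)

Section ResidueField.
Variable k : fieldType.
Implicit Types (f g d A B : {poly k}) (s t : option k).

Lemma cancel_pairP f g : (f != 0) || (g != 0) ->
  exists d A B, [/\ d != 0, f = d * A, g = d * B, coprimep A B
                  & cancel_pair (f, g) = (A, B)].
Proof.
move=> fg; exists (gcdp f g), (f %/ gcdp f g), (g %/ gcdp f g); split=> //.
- by rewrite gcdp_eq0 negb_and.
- by rewrite mulrC divpK // dvdp_gcdl.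
- by rewrite mulrC divpK // dvdp_gcdr.
- exact: coprimep_div_gcd.
Qed.

Lemma size_cofactor f d A : d != 0 -> f = d * A -> A != 0 ->
  (size f = size d + (size A).-1)%N.
Proof.
move=> d0 -> A0; rewrite size_mul //.
by case: (size A) (size_poly_gt0 A) => [|n]; rewrite ?A0 // addnS.
Qed.

Lemma maxn_size_cofactors f g d A B n : d != 0 -> f = d * A -> g = d * B ->
  (maxn (size A) (size B)).-1 = n -> coprimep A B ->
  maxn (size f) (size g) = (size d + n)%N.
Proof.
move=> d0 fE gE <- cop.
have [A0|A0] := eqVneq A 0.
  have B0 : B != 0 by apply: contraTneq cop => ->; rewrite A0 coprime0p eqp01.
  by rewrite fE A0 mulr0 size_poly0 !max0n (size_cofactor d0 gE B0).
have [B0|B0] := eqVneq B 0.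
  by rewrite gE B0 mulr0 size_poly0 !maxn0 (size_cofactor d0 fE A0).
rewrite (size_cofactor d0 fE A0) (size_cofactor d0 gE B0) -addn_maxr; congr addn.
by case: (size A) (size B) => [|n'] [|m']; rewrite ?maxn0 ?max0n ?maxnSS.
Qed.

Lemma coefM2 d A : (size d <= 2)%N -> (size A <= 2)%N ->
  [/\ (d * A)`_0 = d`_0 * A`_0, (d * A)`_1 = d`_0 * A`_1 + d`_1 * A`_0
    & (d * A)`_2 = d`_1 * A`_1].
Proof.
move=> sd sA; rewrite !coefM !big_ord_recr !big_ord0 /= !subn0 subnn.
by rewrite (nth_default _ sd) (nth_default _ sA); split; ring.
Qed.

Lemma px_py_eq0 s t : (px s * py t - px t * py s == 0) = (s == t).
Proof.
case: s t => [x|] [y|] /=.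
- by rewrite !mulr1 subr_eq0.
- by rewrite mulr0 sub0r mulN1r opprK oner_eq0.
- by rewrite mulr0 subr0 mulr1 oppr_eq0 oner_eq0.
- by rewrite !mulr0 subrr !eqxx.
Qed.

Lemma disc_fix_neq0 f g C t1 t2 t3 : fix_factors f g C t1 t2 t3 -> C != 0 ->
  (disc_fix f g != 0) = uniq [:: t1; t2; t3].
Proof.
move=> ff C0; rewrite (disc_fixE ff) mulf_eq0 expf_eq0 (negPf C0) /= sqrf_eq0.
by rewrite !mulf_eq0 !px_py_eq0 /= !inE !negb_or andbT.
Qed.

Lemma rdeg_le2 f g : (size f <= 3)%N -> (size g <= 3)%N -> (rdeg (f, g) <= 2)%N.
Proof.
move=> sf sg; have [fg|] := boolP ((f != 0) || (g != 0)); last first.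
  rewrite negb_or !negbK /rdeg /cancel_pair /= => /andP[/eqP -> /eqP ->].
  by rewrite !div0p size_poly0.
have [d [A [B [d0 fE gE cop cE]]]] := cancel_pairP fg.
have := maxn_size_cofactors d0 fE gE erefl cop; rewrite /rdeg cE /=.
have : (maxn (size f) (size g) <= 3)%N by rewrite geq_max sf.
move=> le3 e; move: le3; rewrite e.
by case: (size d) (size_poly_gt0 d) => [|n]; rewrite ?d0 // addSn ltnS => _;
  apply: leq_trans (leq_addl _ _).
Qed.

(** Degree two leaves only a constant common factor, so no [mu] vanishes. The constant [C] is
    nonzero as well: otherwise [f = 'X * g], and cancelling [g] would leave degree one. *)
Lemma rdeg2_res2 f g C t1 t2 t3 : fix_factors f g C t1 t2 t3 ->
  (size f <= 3)%N -> (size g <= 3)%N -> (f != 0) || (g != 0) ->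
  rdeg (f, g) = 2%N -> res2 f g != 0.
Proof.
move=> ff sf sg fg r2.
have [d [A [B [d0 fE gE cop cE]]]] := cancel_pairP fg.
move: r2; rewrite /rdeg cE /= => r2.
have sz := maxn_size_cofactors d0 fE gE r2 cop.
have sd : size d == 1%N.
  rewrite eqn_leq size_poly_gt0 d0 andbT -(leq_add2r 2) -sz.
  by rewrite geq_max sf.
have copfg : coprimep f g.
  have /size_poly1P[e e0 dE] := sd.
  by rewrite fE gE dE !mul_polyC coprimepZl // coprimepZr.
rewrite (eqP sd) in sz.
rewrite (res2_mu ff) !mulf_neq0 ?(mu_neq0 ff) ?inE ?eqxx ?orbT //.
apply: contraTneq copfg => C0.
case: ff; rewrite C0 oppr0 !mul0r => g2 /eqP; rewrite subr_eq0 => /eqP g1 /eqP.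
rewrite subr_eq0 => /eqP g0 f0.
have fXg : f = 'X * g.
  apply/polyP => -[|[|[|i]]]; rewrite coefXM //=.
  by rewrite [LHS]nth_default ?(leq_trans sf) //; case: i => [|i] //;
    rewrite nth_default // (leq_trans sg).
rewrite fXg coprimepMl coprimepp.
apply/negP => /andP[_ /eqP s1]; move: sz.
rewrite fXg mulrC size_mulX -?size_poly_gt0 ?s1 //.
Qed.

(** Here [f] and [g] are constant multiples of [d], on which the first two forms vanish identically.
    The fixed-point form is nonzero, since [f = 'X * g] with proportional [f] and [g] would force
    [d = 0]. *)
Lemma rdeg0_invariants f g C t1 t2 t3 : fix_factors f g C t1 t2 t3 ->
  (f != 0) || (g != 0) -> rdeg (f, g) = 0%N -> (size f <= 3)%N -> (size g <= 3)%N ->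
  uniq [:: t1; t2; t3] -> [/\ res2 f g = 0, sig1 f g = 0 & disc_fix f g != 0].
Proof.
move=> ff fg r0 sf sg u.
have [d [A [B [d0 fE gE cop cE]]]] := cancel_pairP fg.
move: r0; rewrite /rdeg cE /= => r0.
have sAB : (maxn (size A) (size B) <= 1)%N by rewrite -subn_eq0 subn1 r0.
move: sAB; rewrite geq_max => /andP[/size1_polyC eA /size1_polyC eB].
have fi i : f`_i = d`_i * A`_0 by rewrite fE {1}eA mulrC mul_polyC coefZ mulrC.
have gi i : g`_i = d`_i * B`_0 by rewrite gE {1}eB mulrC mul_polyC coefZ mulrC.
split; try by rewrite /res2 /sig1 !fi !gi; ring.
rewrite (disc_fix_neq0 ff) //; apply: contraNneq d0 => C0.
case: ff; rewrite C0 oppr0 !mul0r => g2 /eqP; rewrite subr_eq0 => /eqP g1 /eqP.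
rewrite subr_eq0 => /eqP g0 f0.
have [B0|B0] := eqVneq B`_0 0.
  have A0 : A`_0 != 0.
    by apply: contraTneq cop => A0; rewrite eA eB A0 B0 coprime0p eqp01.
  have di i : f`_i = 0 -> d`_i = 0 by move/eqP; rewrite fi mulf_eq0 (negPf A0) orbF => /eqP.
  have gz i : g`_i = 0 by rewrite gi B0 mulr0.
  apply/eqP/polyP => -[|[|[|i]]]; rewrite coef0; apply: di => //.
  - by rewrite -g0.
  - by rewrite -g1.
  - by rewrite nth_default // (leq_trans sf).
have di i : g`_i = 0 -> d`_i = 0 by move/eqP; rewrite gi mulf_eq0 (negPf B0) orbF => /eqP.
have fz i : d`_i = 0 -> f`_i = 0 by rewrite fi => ->; rewrite mul0r.
have d2 := di _ g2.
have d1 : d`_1 = 0 by apply: di; rewrite g1 fz.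
have d00 : d`_0 = 0 by apply: di; rewrite g0 fz.
apply/eqP/polyP => -[|[|[|i]]]; rewrite coef0 //.
by apply: di; rewrite nth_default // (leq_trans sg).
Qed.

End ResidueField.

(** * Degree-one maps with a common factor *)

Section DegreeOne.
Variables (k : fieldType) (d A B : {poly k}).
Hypotheses (d0 : d != 0) (sd : (size d <= 2)%N) (cop : coprimep A B)
  (sAB : maxn (size A) (size B) = 2%N).
Implicit Types (t : option k).

Let f := d * A.
Let g := d * B.

Let sA : (size A <= 2)%N. Proof. by rewrite -sAB leq_maxl. Qed.
Let sB : (size B <= 2)%N. Proof. by rewrite -sAB leq_maxr. Qed.

Let fE : [/\ f`_0 = d`_0 * A`_0, f`_1 = d`_0 * A`_1 + d`_1 * A`_0 & f`_2 = d`_1 * A`_1].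
Proof. exact: coefM2. Qed.
Let gE : [/\ g`_0 = d`_0 * B`_0, g`_1 = d`_0 * B`_1 + d`_1 * B`_0 & g`_2 = d`_1 * B`_1].
Proof. exact: coefM2. Qed.

Definition det2 := A`_1 * B`_0 - A`_0 * B`_1.

(** The fixed-point form [X B - Y A] of the degree-one map [(A : B)]; that of the whole lift is [d]
    times it. *)
Definition quad x y := x * (B`_1 * x + B`_0 * y) - y * (A`_1 * x + A`_0 * y).

Lemma linear_hornerE (h : {poly k}) x : (size h <= 2)%N -> h.[x] = h`_1 * x + h`_0.
Proof.
move=> sh; rewrite (horner_coef_wide _ sh) !big_ord_recr big_ord0 /= add0r expr0 expr1.
by rewrite mulr1 addrC.
Qed.

(** If the determinant vanished, the root of whichever of [A], [B] has degree one would be a root of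
    the other. *)
Lemma det2_neq0 : det2 != 0.
Proof.
have size2 (h : {poly k}) : (size h <= 2)%N -> h`_1 = 0 -> (size h <= 1)%N.
  move=> sh h1; apply/leq_sizeP => j; rewrite leq_eqVlt => /orP[/eqP<-//|lj].
  by rewrite nth_default // (leq_trans sh lj).
have [A1|A1] := eqVneq A`_1 0; last first.
  have rA : root A (- A`_0 / A`_1).
    by rewrite /root linear_hornerE //; apply/eqP; field.
  have := coprimep_root cop rA; rewrite linear_hornerE //; apply: contraNneq => e.
  have -> : B`_1 * (- A`_0 / A`_1) + B`_0 = det2 / A`_1 by rewrite /det2; field.
  by rewrite e mul0r.
have [B1|B1] := eqVneq B`_1 0.
  have : (maxn (size A) (size B) <= 1)%N by rewrite geq_max !size2.
  by rewrite sAB.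
have rB : root B (- B`_0 / B`_1).
  by rewrite /root linear_hornerE //; apply/eqP; field.
move: cop; rewrite coprimep_sym => /coprimep_root/(_ rB).
rewrite linear_hornerE //; apply: contraNneq => e.
have -> : A`_1 * (- B`_0 / B`_1) + A`_0 = - det2 / B`_1 by rewrite /det2; field.
by rewrite e oppr0 mul0r.
Qed.

Lemma moved_quad t : cancel_pair (f, g) = (A, B) ->
  evalP1 (f, g) t != t -> quad (px t) (py t) != 0.
Proof.
move=> cE; rewrite /evalP1 cE /= sAB /=; case: t => [x|] /=.
  rewrite !linear_hornerE // /quad !mulr1 mul1r.
  have [Bx|Bx] /= := eqVneq (B`_1 * x + B`_0) 0.
    (* At a pole, [quad] is minus the value of [A]; if that vanished too, the determinant would be
       zero. *)
    rewrite Bx mulr0 sub0r oppr_eq0 => _; apply: contraTneq det2_neq0 => Ax.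
    rewrite negbK; apply/eqP.
    rewrite (_ : det2 = A`_1 * (B`_1 * x + B`_0) - B`_1 * (A`_1 * x + A`_0)).
      by rewrite Ax Bx; ring.
    by rewrite /det2; ring.
  apply: contra_neq => /eqP; rewrite subr_eq0 => /eqP <-.
  by rewrite mulfK.
rewrite /quad; have [B1 /eqP|B1 _] := eqVneq B`_1 0; first by [].
by rewrite [X in X != _](_ : _ = B`_1) //; ring.
Qed.

(** The point [t3] is a zero of [d * quad] but not of [quad], so [d], taken as a linear form, is a
    multiple [s] of the form of [t3]. Cancelling it leaves [t1] and [t2] as the zeros of [quad]. *)
Lemma quad_factors C t1 t2 t3 :
  fix_factors f g C t1 t2 t3 -> quad (px t3) (py t3) != 0 ->
  exists s e, [/\ s != 0, d`_1 = s * py t3, d`_0 = - (s * px t3)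
   & [/\ B`_1 = e * (py t1 * py t2),
      B`_0 - A`_1 = - e * (px t1 * py t2 + px t2 * py t1)
    & A`_0 = - e * (px t1 * px t2)]].
Proof.
move=> [e3 e2 e1 e0] q0.
have [f0 f1 f2] := fE; have [g0 g1 g2] := gE.
have dz : d`_1 = 0 -> d`_0 = 0 -> False.
  move=> d1 d00; move/eqP: d0; apply; apply/polyP => -[|[|i]]; rewrite coef0 //.
  by rewrite nth_default // (leq_trans sd).
(* The fixed-point form vanishes at [t3]; expand it once as [d * quad] and once by its factors. *)
have dt : d`_1 * px t3 + d`_0 * py t3 = 0.
  apply/eqP; rewrite -(mulIr_eq0 _ (mulIf q0)); apply/eqP.
  transitivity (g`_2 * px t3 ^+ 3 + (g`_1 - f`_2) * px t3 ^+ 2 * py t3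
    + (g`_0 - f`_1) * px t3 * py t3 ^+ 2 - f`_0 * py t3 ^+ 3).
    by rewrite f0 f1 f2 g0 g1 g2 /quad; ring.
  by rewrite e3 e2 e1 e0; ring.
rewrite f0 f1 f2 g0 g1 g2 in e3 e2 e1 e0.
case: t3 q0 dt e3 e2 e1 e0 => [x|] /= q0 dt e3 e2 e1 e0.
  have d0E : d`_0 = - (d`_1 * x) by apply/eqP; rewrite -addr_eq0 addrC -[d`_0]mulr1 dt.
  have s0 : d`_1 != 0 by apply/eqP => z; apply: dz => //; rewrite d0E z mul0r oppr0.
  exists d`_1, (C / d`_1); split=> //; rewrite ?mulr1 //.
  have b1 : B`_1 = C / d`_1 * (py t1 * py t2).
    by apply: (mulfI s0); rewrite e3; field.
  have ba : B`_0 - A`_1 = - (C / d`_1) * (px t1 * py t2 + px t2 * py t1).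
    apply: (mulfI s0); transitivity
      ((d`_0 * B`_1 + d`_1 * B`_0 - d`_1 * A`_1) - d`_0 * B`_1); first by ring.
    by rewrite e2 d0E b1; field.
  split=> //; apply: (mulfI s0); transitivity
    (d`_0 * (B`_0 - A`_1) - (d`_0 * B`_0 - (d`_0 * A`_1 + d`_1 * A`_0))); first by ring.
  by rewrite e1 ba d0E; field.
have d1 : d`_1 = 0.
  by apply/eqP; rewrite -oppr_eq0 -mulrN1 -[X in X == _]addr0
    -[X in _ + X](mulr0 d`_0) dt.
have s0 : d`_0 != 0 by apply/eqP => z; apply: dz.
exists d`_0, (C / d`_0); rewrite mulrN1 opprK mulr0; split=> //; split; apply: (mulfI s0).
- transitivity (d`_0 * B`_1 + d`_1 * B`_0 - d`_1 * A`_1); first by rewrite d1; ring.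
  by rewrite e2; field.
- transitivity (d`_0 * B`_0 - (d`_0 * A`_1 + d`_1 * A`_0)); first by rewrite d1; ring.
  by rewrite e1; field.
- by rewrite e0; field.
Qed.

(** The zero of [d] is [(d_0 : - d_1)], so this value of [quad] is the resultant of [d] and [quad]
    up to sign. The discriminant formula is that of a product, the discriminant of [quad] being
    trace squared minus four times determinant. *)
Lemma deg1_invariants :
  [/\ res2 f g = 0, sig1 f g = - det2 * quad d`_0 (- d`_1) ^+ 2
   & disc_fix f g = ((A`_1 + B`_0) ^+ 2 - 4 * det2) * quad d`_0 (- d`_1) ^+ 2].
Proof.
have [f0 f1 f2] := fE; have [g0 g1 g2] := gE.
by split; rewrite /res2 /sig1 /disc_fix f0 f1 f2 g0 g1 g2 /det2 /quad; ring.
Qed.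

(** The factor [D] is [d] after the substitution, nonzero because the substitution is invertible. *)
Lemma hcomp_deg1 al be ga de : al * de - be * ga != 0 ->
  exists2 D : {poly k}, D != 0 &
    let L1 := al *: 'X + be%:P in let L2 := ga *: 'X + de%:P in
    hcomp (f, g) al be ga de =
      (D * (A`_1 *: L1 + A`_0 *: L2), D * (B`_1 *: L1 + B`_0 *: L2)).
Proof.
move=> r0; have [f0 f1 f2] := fE; have [g0 g1 g2] := gE.
have dz : d`_1 = 0 -> d`_0 = 0 -> False.
  move=> d1 d00; move/eqP: d0; apply; apply/polyP => -[|[|i]]; rewrite coef0 //.
  by rewrite nth_default // (leq_trans sd).
have := maxn_size_cofactors d0 erefl erefl erefl cop; rewrite sAB -/f -/g addn1 => sz.
rewrite /hcomp /= sz /=.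
move: (sd); rewrite leq_eqVlt => /orP[/eqP s2|s1].
  rewrite s2; exists (d`_1 *: (al *: 'X + be%:P) + d`_0 *: (ga *: 'X + de%:P)).
    apply/eqP => z; apply: dz.
      apply: (mulIf r0); rewrite mul0r.
      have z0 := congr1 (fun h : {poly k} => h`_0) z.
      have z1 := congr1 (fun h : {poly k} => h`_1) z.
      move: z0 z1; rewrite !pcoefE /= => z0 z1.
      transitivity (de * (d`_1 * (al * 1 + 0) + d`_0 * (ga * 1 + 0)) -
         ga * (d`_1 * (al * 0 + be) + d`_0 * (ga * 0 + de))); first by ring.
      by rewrite z0 z1; ring.
    apply: (mulIf r0); rewrite mul0r.
    have z0 := congr1 (fun h : {poly k} => h`_0) z.
    have z1 := congr1 (fun h : {poly k} => h`_1) z.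
    move: z0 z1; rewrite !pcoefE /= => z0 z1.
    transitivity (al * (d`_1 * (al * 0 + be) + d`_0 * (ga * 0 + de)) -
       be * (d`_1 * (al * 1 + 0) + d`_0 * (ga * 1 + 0))); first by ring.
    by rewrite z0 z1; ring.
  rewrite !big_ord_recr !big_ord0 /= !subn0 subnn f0 f1 f2 g0 g1 g2.
  by congr pair; rewrite -!mul_polyC !(polyCD, polyCM); ring.
(* A constant [d] has its zero at infinity. [hcomp] homogenizes in the actual degree, now one, so
   this zero contributes no factor. *)
have {}s1 : size d = 1%N by apply/eqP; rewrite eqn_leq -ltnS s1 size_poly_gt0.
have d1 : d`_1 = 0 by rewrite nth_default // s1.
rewrite s1; exists (d`_0)%:P; first by rewrite polyC_eq0; apply/eqP => /(dz d1).
rewrite !big_ord_recr !big_ord0 /= !subn0 f0 f1 g0 g1 d1.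
by congr pair; rewrite -!mul_polyC !(polyCD, polyCM); ring.
Qed.

Lemma conj_deg1 al be ga de (T1 T2 : {poly k}) : al * de - be * ga != 0 ->
  let L1 := al *: 'X + be%:P in let L2 := ga *: 'X + de%:P in
  (A`_1 *: L1 + A`_0 *: L2) * (ga *: T1 + de *: T2) =
  (B`_1 *: L1 + B`_0 *: L2) * (al *: T1 + be *: T2) ->
  conj_k (f, g) (T1, T2).
Proof.
move=> r0 /= e; exists al, be, ga, de; split=> //.
have [D _ ->] := hcomp_deg1 r0.
by rewrite /pequiv /postmob /= -!mulrA e.
Qed.

(** Up to a scalar [s] the matrix of [(A : B)] is conjugate to a unipotent one, so its trace is
    [2 * s] and its determinant [s ^+ 2]. *)
Lemma conj_translation at_ : conj_k (f, g) ('X + at_%:P, 1) ->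
  (A`_1 + B`_0) ^+ 2 = 4 * det2.
Proof.
case=> al [be [ga [de [r0]]]].
have [D D0 ->] := hcomp_deg1 r0.
rewrite /pequiv /postmob /= -!mulrA => /(mulfI D0) e.
pose a1 := A`_1 * al + A`_0 * ga; pose a0 := A`_1 * be + A`_0 * de.
pose b1 := B`_1 * al + B`_0 * ga; pose b0 := B`_1 * be + B`_0 * de.
pose c1 := al; pose c0 := al * at_ + be; pose d1' := ga; pose d0' := ga * at_ + de.
have eA : A`_1 *: (al *: 'X + be%:P) + A`_0 *: (ga *: 'X + de%:P) = a1 *: 'X + a0%:P.
  by rewrite -!mul_polyC !(polyCD, polyCM); ring.
have eB : B`_1 *: (al *: 'X + be%:P) + B`_0 *: (ga *: 'X + de%:P) = b1 *: 'X + b0%:P.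
  by rewrite -!mul_polyC !(polyCD, polyCM); ring.
have eC : al *: ('X + at_%:P) + be *: 1 = c1 *: 'X + c0%:P.
  by rewrite -!mul_polyC !(polyCD, polyCM); ring.
have eD : ga *: ('X + at_%:P) + de *: 1 = d1' *: 'X + d0'%:P.
  by rewrite -!mul_polyC !(polyCD, polyCM); ring.
have prodE (u1 u0 w1 w0 : k) : (u1 *: 'X + u0%:P) * (w1 *: 'X + w0%:P) =
    (u1 * w1) *: 'X^2 + (u1 * w0 + u0 * w1) *: 'X + (u0 * w0)%:P.
  by rewrite -!mul_polyC !(polyCD, polyCM); ring.
rewrite eA eB eC eD !prodE in e.
have E i := congr1 (fun h : {poly k} => h`_i) e.
move: (E 0%N) (E 1%N) (E 2%N); rewrite !(coefD, coefZ, coefXn, coefX, coefC) /=.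
rewrite !(mulr0, mulr1, addr0, add0r) => E0 E1 E2.
have rE : c1 * d0' - c0 * d1' = al * de - be * ga by rewrite /c1 /d0' /c0 /d1'; ring.
(* The scalar relating the two matrices, found by Cramer's rule; the linear coefficient [E1] gives
   it a second expression in [s']. *)
pose s := (a1 * d0' - b1 * c0) / (c1 * d0' - c0 * d1').
have r0' : c1 * d0' - c0 * d1' != 0 by rewrite rE.
have sE : s * (c1 * d0' - c0 * d1') = a1 * d0' - b1 * c0 by rewrite /s divfK.
have A1E : a1 = s * c1.
  apply: (mulIf r0'); rewrite mulrAC sE.
  transitivity (c1 * a1 * d0' - c0 * (a1 * d1')); first by ring.
  by rewrite E2; ring.
have B1E : b1 = s * d1'.
  apply: (mulIf r0'); rewrite mulrAC sE.
  transitivity ((b1 * c1) * d0' - d1' * b1 * c0); first by ring.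
  by rewrite -E2; ring.
have s' : s * (c1 * d0' - c0 * d1') = b0 * c1 - a0 * d1'.
  rewrite sE; apply/eqP; rewrite -subr_eq0; apply/eqP.
  transitivity ((a1 * d0' + a0 * d1') - (b1 * c0 + b0 * c1)); first by ring.
  by rewrite E1 subrr.
have A0E : a0 = s * c0.
  apply: (mulIf r0'); rewrite [RHS]mulrAC s'.
  transitivity (c1 * (a0 * d0') - c0 * a0 * d1'); first by ring.
  by rewrite E0; ring.
have B0E : b0 = s * d0'.
  apply: (mulIf r0'); rewrite [RHS]mulrAC s'.
  transitivity (b0 * c1 * d0' - d1' * (b0 * c0)); first by ring.
  by rewrite -E0; ring.
have invE (M1 M0 : k) :
    M1 * (al * de - be * ga) = (M1 * al + M0 * ga) * de - (M1 * be + M0 * de) * ga /\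
    M0 * (al * de - be * ga) = (M1 * be + M0 * de) * al - (M1 * al + M0 * ga) * be.
  by split; ring.
have [eA1 eA0] := invE A`_1 A`_0; have [eB1 eB0] := invE B`_1 B`_0.
rewrite -/a1 -/a0 A1E A0E in eA1 eA0; rewrite -/b1 -/b0 B1E B0E in eB1 eB0.
have tr : A`_1 + B`_0 = 2 * s.
  by apply: (mulIf r0); rewrite mulrDl eA1 eB0 /c1 /c0 /d1' /d0'; ring.
have dt : det2 = s ^+ 2.
  apply: (mulIf (mulf_neq0 r0 r0)).
  transitivity ((A`_1 * (al * de - be * ga)) * (B`_0 * (al * de - be * ga))
     - (A`_0 * (al * de - be * ga)) * (B`_1 * (al * de - be * ga))).
    by rewrite /det2; ring.
  by rewrite eA1 eA0 eB1 eB0 /c1 /c0 /d1' /d0'; ring.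
by rewrite tr dt; ring.
Qed.

End DegreeOne.

(* Cramer's rule for the Sylvester matrix of two quadratic forms. *)
Lemma res2_cramer (k : idomainType) (f g : {poly k}) (c1 c0 d1 d0 : k) :
  res2 f g != 0 ->
  f`_0 * d0 = g`_0 * c0 ->
  f`_0 * d1 + f`_1 * d0 = g`_0 * c1 + g`_1 * c0 ->
  f`_1 * d1 + f`_2 * d0 = g`_1 * c1 + g`_2 * c0 ->
  f`_2 * d1 = g`_2 * c1 ->
  [/\ c1 = 0, c0 = 0, d1 = 0 & d0 = 0].
Proof.
rewrite /res2.
move: f`_0 f`_1 f`_2 g`_0 g`_1 g`_2 => F0 F1 F2 G0 G1 G2 r0.
move=> /eqP; rewrite -subr_eq0 => /eqP E0 /eqP; rewrite -subr_eq0 => /eqP E1.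
move=> /eqP; rewrite -subr_eq0 => /eqP E2 /eqP; rewrite -subr_eq0 => /eqP E3.
pose M u3 u2 u1 u0 := u3 * (F2 * d1 - G2 * c1)
  + u2 * (F1 * d1 + F2 * d0 - (G1 * c1 + G2 * c0))
  + u1 * (F0 * d1 + F1 * d0 - (G0 * c1 + G1 * c0)) + u0 * (F0 * d0 - G0 * c0).
have M0 u3 u2 u1 u0 : M u3 u2 u1 u0 = 0 by rewrite /M E0 E1 E2 E3; ring.
split; apply: (mulfI r0); rewrite mulr0.
- rewrite -(M0 (- F1 * F1 * G0 + F1 * G1 * F0 + F2 * F0 * G0 - G2 * F0 * F0)
    (F2 * F1 * G0 - F2 * G1 * F0) (- F2 * F2 * G0 + F2 * G2 * F0)
    (F2 * F2 * G1 - F2 * G2 * F1)) /M; ring.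
- rewrite -(M0 (- F1 * G0 * F0 + G1 * F0 * F0) (F2 * G0 * F0 - G2 * F0 * F0)
    (- F2 * G1 * F0 + G2 * F1 * F0)
    (- F2 * F2 * G0 + F2 * G1 * F1 - G2 * F1 * F1 + G2 * F2 * F0)) /M; ring.
- rewrite -(M0 (F2 * G0 * G0 - G1 * F1 * G0 + G1 * G1 * F0 - G2 * G0 * F0)
    (G2 * F1 * G0 - G2 * G1 * F0) (- G2 * F2 * G0 + G2 * G2 * F0)
    (G2 * F2 * G1 - G2 * G2 * F1)) /M; ring.
- rewrite -(M0 (- F1 * G0 * G0 + G1 * F0 * G0) (F2 * G0 * G0 - G2 * F0 * G0)
    (- F2 * G1 * G0 + G2 * F1 * G0)
    (F2 * G1 * G1 - F2 * G2 * G0 - G2 * F1 * G1 + G2 * G2 * F0)) /M; ring.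
Qed.

(** Substitution keeps the resultant nonzero, so the two substituted quadratics admit no nontrivial
    syzygy with linear coefficients. General [m] and [n] cover both the scaling and the translation
    normal forms. *)
Lemma res2_not_conj (k : fieldType) (f g : {poly k}) (m n : k) :
  (size f <= 3)%N -> (size g <= 3)%N -> res2 f g != 0 ->
  ~ conj_k (f, g) (m *: 'X + n%:P, 1).
Proof.
move=> sf sg r0 [al [be [ga [de [det0]]]]].
have small (h : {poly k}) : (size h <= 2)%N -> h`_2 = 0 by apply: nth_default.
have sz : maxn (size f) (size g) = 3%N.
  apply/eqP; rewrite eqn_leq geq_max sf sg /= ltnNge; apply: contraNN r0.
  by rewrite geq_max => /andP[/small f2 /small g2]; rewrite /res2 f2 g2; apply/eqP; ring.
rewrite /pequiv /postmob /hcomp /= sz /=.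
pose h0 (u : {poly k}) := u`_0 * de ^+ 2 + u`_1 * be * de + u`_2 * be ^+ 2.
pose h1 (u : {poly k}) :=
  2 * u`_0 * ga * de + u`_1 * (al * de + be * ga) + 2 * u`_2 * al * be.
pose h2 (u : {poly k}) := u`_0 * ga ^+ 2 + u`_1 * al * ga + u`_2 * al ^+ 2.
pose H u := h2 u *: 'X^2 + h1 u *: 'X + (h0 u)%:P.
have HE (u : {poly k}) : \sum_(i < 3) u`_i *:
    ((al *: 'X + be%:P) ^+ i * (ga *: 'X + de%:P) ^+ (2 - i)) = H u.
  rewrite !big_ord_recr big_ord0 /= !subn0 subnn /H /h2 /h1 /h0.
  by rewrite -!mul_polyC !(polyCD, polyCM); ring.
have H0 u : (H u)`_0 = h0 u by rewrite !(coefD, coefZ, coefXn, coefX, coefC) /=; ring.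
have H1 u : (H u)`_1 = h1 u by rewrite !(coefD, coefZ, coefXn, coefX, coefC) /=; ring.
have H2 u : (H u)`_2 = h2 u by rewrite !(coefD, coefZ, coefXn, coefX, coefC) /=; ring.
have rH : res2 (H f) (H g) != 0.
  rewrite (_ : res2 _ _ = (al * de - be * ga) ^+ 4 * res2 f g).
    by rewrite mulf_neq0 // expf_neq0.
  by rewrite /res2 !H0 !H1 !H2 /h0 /h1 /h2; ring.
rewrite !HE; set c1 := al * m; set c0 := al * n + be.
set d1 := ga * m; set d0 := ga * n + de.
have linE (x y : k) : x *: (m *: 'X + n%:P) + y *: 1 = (x * m) *: 'X + (x * n + y)%:P.
  by rewrite -!mul_polyC !(polyCD, polyCM); ring.
rewrite !linE -/c1 -/c0 -/d1 -/d0 => e.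
have prodE u (x y : k) : H u * (x *: 'X + y%:P) =
    (h2 u * x) *: 'X^3 + (h1 u * x + h2 u * y) *: 'X^2
    + (h0 u * x + h1 u * y) *: 'X + (h0 u * y)%:P.
  by rewrite /H -!mul_polyC !(polyCD, polyCM); ring.
rewrite !prodE in e.
have E i := congr1 (fun P : {poly k} => P`_i) e.
have E0 := E 0%N; have E1 := E 1%N; have E2 := E 2%N; have E3 := E 3%N.
move: E0 E1 E2 E3; rewrite !(coefD, coefZ, coefXn, coefX, coefC) /=.
rewrite !(mulr0, mulr1, addr0, add0r) => E0 E1 E2 E3.
have [c10 c00 d10 d00] : [/\ c1 = 0, c0 = 0, d1 = 0 & d0 = 0].
  by apply: (res2_cramer rH); rewrite !(H0, H1, H2).
move/eqP: det0; apply.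
(* The coefficients shown to vanish determine the determinant of the coordinate change. *)
have -> : al * de - be * ga = al * d0 - ga * c0 by rewrite /d0 /c0; ring.
by rewrite c00 d00; ring.
Qed.

(** What the comparison needs in degree one, stated for a list so that the fixed directions can be
    permuted to put a moved one last. *)
Definition degree1_type (k : fieldType) (f g : {poly k}) (ts : seq (option k)) : Prop :=
  [/\ res2 f g = 0, sig1 f g != 0, (1 < size (undup ts))%N,
      forall at_, conj_k (f, g) ('X + at_%:P, 1) -> disc_fix f g = 0
    & if uniq ts then
        [/\ disc_fix f g != 0,
            exists2 ct, (ct != 0) && (ct != 1) & conj_k (f, g) (ct *: 'X, 1)
          & exists2 t, t \in ts & [/\ mu f g t != 0, tau f g t != 0 &
              tau f g t / mu f g t + mu f g t / tau f g t
                = 2 - disc_fix f g / sig1 f g]]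
      else disc_fix f g = 0 /\
        exists2 at_, at_ != 0 & conj_k (f, g) ('X + at_%:P, 1)].

Lemma degree1_type_perm (k : fieldType) (f g : {poly k}) ts us :
  perm_eq ts us -> degree1_type f g ts -> degree1_type f g us.
Proof.
move=> tu [r0 s0 sz tr H]; split=> //.
  by rewrite -(perm_size (perm_undup (perm_mem tu))).
rewrite -(perm_uniq tu); case: ifP H => // _ [dn cn [t tin tP]]; split=> //.
by exists t; rewrite -?(perm_mem tu).
Qed.

(** * Normal forms in degree one *)

Section DegreeOne.
Variables (k : fieldType) (d A B : {poly k}).
Hypotheses (d0 : d != 0) (sd : (size d <= 2)%N) (cop : coprimep A B)
  (sAB : maxn (size A) (size B) = 2%N).
Let f := d * A.
Let g := d * B.

(** The points [t1] and [t2] are the fixed points of [(A : B)], while [t3] is the zero of [d] and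
    differs from both. Distinct [t1] and [t2] diagonalize the map; a double one makes it a
    translation. *)
Lemma degree1_typeP C t1 t2 t3 :
  fix_factors f g C t1 t2 t3 -> quad A B (px t3) (py t3) != 0 ->
  degree1_type f g [:: t1; t2; t3].
Proof.
move=> ff q0; have D0 := det2_neq0 cop sAB.
have [s [e [s0 d1E d0E [B1E BAE A0E]]]] := quad_factors d0 sd sAB ff q0.
have [res0 s1E dcE] := deg1_invariants sd sAB.
rewrite -/f -/g in res0 s1E dcE.
have sA : (size A <= 2)%N by rewrite -sAB leq_maxl.
have sB : (size B <= 2)%N by rewrite -sAB leq_maxr.
have [f0 f1 f2] := coefM2 sd sA; rewrite -/f in f0 f1 f2.
have [g0 g1 g2] := coefM2 sd sB; rewrite -/g in g0 g1 g2.
have B0E : B`_0 = A`_1 - e * (px t1 * py t2 + px t2 * py t1).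
  by rewrite -[LHS](subrK A`_1) BAE; ring.
have qE x y : quad A B x y = e * (py t1 * x - px t1 * y) * (py t2 * x - px t2 * y).
  by rewrite /quad B1E B0E A0E; ring.
have [e0 n31 n32] : [/\ e != 0, t3 != t1 & t3 != t2].
  move: q0; rewrite qE !mulf_eq0 !negb_or -!px_py_eq0 => /andP[/andP[-> h1] h2].
  by split=> //; [move: h1|move: h2]; congr (_ != 0); ring.
(* The eigenvalues of [(A : B)] on the coordinate vectors of [t1] and [t2]. *)
pose e1 := A`_1 - e * (px t2 * py t1); pose e2 := A`_1 - e * (px t1 * py t2).
have detE : det2 A B = e1 * e2 by rewrite /det2 B1E B0E A0E /e1 /e2; ring.
have [e10 e20] : e1 != 0 /\ e2 != 0.
  by move: D0; rewrite detE mulf_eq0 negb_or => /andP[].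
have A1v : A`_1 * px t1 + A`_0 * py t1 = e1 * px t1 by rewrite A0E /e1; ring.
have A2v : A`_1 * px t2 + A`_0 * py t2 = e2 * px t2 by rewrite A0E /e2; ring.
have B1v : B`_1 * px t1 + B`_0 * py t1 = e1 * py t1 by rewrite B1E B0E /e1; ring.
have B2v : B`_1 * px t2 + B`_0 * py t2 = e2 * py t2 by rewrite B1E B0E /e2; ring.
have e12 : e1 - e2 = e * (px t1 * py t2 - px t2 * py t1) by rewrite /e1 /e2; ring.
have qd : quad A B d`_0 (- d`_1) != 0.
  have -> : quad A B d`_0 (- d`_1) = s ^+ 2 * quad A B (px t3) (py t3).
    by rewrite d0E d1E /quad; ring.
  by rewrite mulf_neq0 // expf_neq0.
have s1n : sig1 f g != 0 by rewrite s1E mulf_neq0 ?oppr_eq0 // expf_neq0.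
have dcE' : disc_fix f g = (e1 - e2) ^+ 2 * quad A B d`_0 (- d`_1) ^+ 2.
  by rewrite dcE detE B0E /e1 /e2; ring.
split=> //.
- rewrite /= !inE; case: (t1 == t2) => /=; rewrite ?inE (eq_sym t2) (negPf n32) //=.
  by rewrite (eq_sym t1) (negPf n31).
- move=> at_ /(conj_translation d0 sd cop sAB) tr.
  by rewrite dcE tr subrr mul0r.
have -> : uniq [:: t1; t2; t3] = (t1 != t2).
  by rewrite /= !inE (eq_sym t1 t3) (eq_sym t2 t3) (negPf n31) (negPf n32) /= orbF !andbT.
have [t12|t12] /= := eqVneq t1 t2.
  have e12E : e1 = e2 by apply/eqP; rewrite -subr_eq0 e12 t12 subrr mulr0.
  split; first by rewrite dcE' e12E subrr expr0n mul0r.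
  (* The new coordinate sends infinity to [t1], whose vector is completed to a matrix of determinant
     -1; the map becomes translation by [e / e1]. *)
  exists (e / e1); first by rewrite mulf_neq0 ?invr_eq0.
  have [be [de r1]] : exists be de, py t1 * be - px t1 * de = 1.
    by case: (t1) => [x|]; [exists 1, 0|exists 0, 1]; rewrite /=; ring.
  have r0 : px t1 * de - be * py t1 != 0.
    by rewrite -oppr_eq0 (_ : - _ = 1) ?oner_eq0 // -r1; ring.
  apply: (conj_deg1 d0 sd cop sAB r0) => /=.
  have e1e (u w : k) : e1 * (u * (e / e1) + w) = u * e * (py t1 * be - px t1 * de) + e1 * w.
    by rewrite r1; field.
  have Av : A`_1 * be + A`_0 * de = e1 * (px t1 * (e / e1) + be).
    by rewrite e1e A0E /e1 -t12; ring.
  have Bv : B`_1 * be + B`_0 * de = e1 * (py t1 * (e / e1) + de).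
    by rewrite e1e B1E B0E /e1 -t12; ring.
  have linE (M1 M0 : k) : M1 *: (px t1 *: 'X + be%:P) + M0 *: (py t1 *: 'X + de%:P) =
     (M1 * px t1 + M0 * py t1) *: 'X + (M1 * be + M0 * de)%:P.
    by rewrite -!mul_polyC !(polyCD, polyCM); ring.
  rewrite !linE A1v B1v Av Bv -!mul_polyC !(polyCD, polyCM); ring.
have r0 : px t1 * py t2 - px t2 * py t1 != 0 by rewrite px_py_eq0.
have e12n : e1 != e2 by rewrite -subr_eq0 e12 mulf_neq0.
split.
- by rewrite dcE' mulf_neq0 // expf_neq0 // subr_eq0.
(* The new coordinate sends infinity to [t1] and 0 to [t2], so the map becomes scaling by the ratio
   of eigenvalues. *)
- exists (e1 / e2); first rewrite mulf_neq0 ?invr_eq0 //=.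
    by apply: contra_neq e12n => /(canRL (divfK e20)); rewrite mul1r.
  apply: (conj_deg1 d0 sd cop sAB r0) => /=.
  have linE (M1 M0 : k) : M1 *: (px t1 *: 'X + (px t2)%:P) + M0 *: (py t1 *: 'X + (py t2)%:P) =
     (M1 * px t1 + M0 * py t1) *: 'X + (M1 * px t2 + M0 * py t2)%:P.
    by rewrite -!mul_polyC !(polyCD, polyCM); ring.
  have e1E : e1 = e1 / e2 * e2 by rewrite divfK.
  rewrite !linE A1v B1v A2v B2v {1 3}e1E; move: (e1 / e2) => ct.
  by rewrite -!mul_polyC !(polyCD, polyCM); ring.
exists t1; first by rewrite inE eqxx.
(* The value of [d] at [t1], nonzero since [d] vanishes only at [t3]. *)
pose h1 := d`_1 * px t1 + d`_0 * py t1.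
have h10 : h1 != 0.
  rewrite /h1 d1E d0E (_ : _ + _ = - (s * (px t3 * py t1 - px t1 * py t3))); last by ring.
  by rewrite oppr_eq0 mulf_neq0 // px_py_eq0.
have muE : mu f g t1 = h1 * e1.
  rewrite /mu /hval /h1 /e1; case: (t1) B1E B0E A0E => [x|] /= B1E B0E A0E.
    by rewrite g0 g1 g2 B1E B0E; ring.
  by rewrite f2; ring.
have tauE : tau f g t1 = h1 * e2.
  by rewrite /tau muE f1 f2 g0 g1 /h1 /e1 /e2 B1E B0E A0E; ring.
(* This is [e2 / e1 + e1 / e2 = 2 + (e1 - e2)^2 / (e1 e2)]; the squared value of [quad] cancels in
   the quotient of the two forms. *)
rewrite muE tauE dcE' s1E detE !mulf_neq0 //; split=> //.
by field; rewrite h10 qd oppr_eq0 mulf_neq0 ?e10 ?e20.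
Qed.

End DegreeOne.

(** A moved direction is not a zero of [quad]. The factorization is symmetric in the three
    directions, so this one may be taken as the third. *)
Lemma rdeg1_type (k : fieldType) (f g : {poly k}) C t1 t2 t3 :
  fix_factors f g C t1 t2 t3 -> (size f <= 3)%N -> (size g <= 3)%N ->
  (f != 0) || (g != 0) -> rdeg (f, g) = 1%N ->
  has (fun t => evalP1 (f, g) t != t) [:: t1; t2; t3] ->
  degree1_type f g [:: t1; t2; t3].
Proof.
move=> ff sf sg fg r1 /hasP[t tin mv].
have [d [A [B [d0 fE gE cop cE]]]] := cancel_pairP fg.
move: r1; rewrite /rdeg cE /= => r1.
have sz := maxn_size_cofactors d0 fE gE r1 cop.
have sd : (size d <= 2)%N by rewrite -(leq_add2r 1) -sz geq_max sf.
have sAB : maxn (size A) (size B) = 2%N by case: (maxn _ _) r1 => // n /= ->.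
subst f g; have q0 := moved_quad cop sAB cE mv.
move: ff => [e3 e2 e1 e0].
have main s1 s2 s3 : fix_factors (d * A) (d * B) C s1 s2 s3 -> t = s3 ->
    degree1_type (d * A) (d * B) [:: s1; s2; s3].
  by move=> ff ts; apply: (degree1_typeP d0 sd cop sAB ff); rewrite -ts.
move: tin; rewrite !inE => /or3P[] /eqP ts.
- apply: (@degree1_type_perm _ _ _ [:: t2; t3; t1]).
    by rewrite (perm_catCA [:: t2; t3] [:: t1] [::]) perm_refl.
  by apply: main ts; split; rewrite ?e3 ?e2 ?e1 ?e0; ring.
- apply: (@degree1_type_perm _ _ _ [:: t1; t3; t2]).
    by rewrite perm_cons (perm_catC [:: t3] [:: t2]).
  by apply: main ts; split; rewrite ?e3 ?e2 ?e1 ?e0; ring.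
- exact: main ts.
Qed.

(** * Comparison with the crucial point *)

Lemma size_undup3 (T : eqType) (t1 t2 t3 : T) :
  (3 <= size (undup [:: t1; t2; t3]))%N = uniq [:: t1; t2; t3].
Proof. by rewrite leqNgt -[X in (_ < X)%N]/(size [:: t1; t2; t3]) ltn_size_undup negbK. Qed.

Section ProjectiveClasses.
Variables (k : fieldType) (e s1 s2 r : k).
Hypothesis e0 : e != 0.
Let S := (e * s1, e * s2, e * r).

Lemma proj_eq_1x0 x : proj_eq S (1, x, 0) <-> [/\ r = 0, s1 != 0 & s2 = x * s1].
Proof.
rewrite /S; split=> [[c c0 []]|[-> s10 ->]] /=.
  rewrite mulr1 mulr0 => e1 e2 /eqP; rewrite mulf_eq0 (negPf e0) /= => /eqP r0.
  split=> //; first by apply: contraNneq c0 => s10; rewrite -e1 s10 mulr0.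
  by apply: (mulfI e0); rewrite e2 -e1; ring.
by exists (e * s1); rewrite ?mulf_neq0 //=; congr (_, _, _); ring.
Qed.

Lemma proj_eq_010 : proj_eq S (0, 1, 0) <-> [/\ r = 0, s1 = 0 & s2 != 0].
Proof.
rewrite /S; split=> [[c c0 []]|[-> -> s20]] /=.
  rewrite mulr1 mulr0 => /eqP; rewrite mulf_eq0 (negPf e0) /= => /eqP -> e2 /eqP.
  rewrite mulf_eq0 (negPf e0) /= => /eqP ->; split=> //.
  by apply: contraNneq c0 => s20; rewrite -e2 s20 mulr0.
by exists (e * s2); rewrite ?mulf_neq0 //=; congr (_, _, _); ring.
Qed.

End ProjectiveClasses.

Theorem theorem1p1 (R : realType) (K : closedFieldType) (v : nonarch_abs K R)
  (k : fieldType) (rd : residue_map v k)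
  (p q : {poly K}) (x1 x2 x3 : option K) (a c : K) :
  coprimep p q -> maxn (size p) (size q) = 3%N ->
  fixpt_list p q [:: x1; x2; x3] ->
  c != 0 -> 0 < weight rd p q [:: x1; x2; x3] a c ->
  let l1 := mult2 p q x1 in
  let l2 := mult2 p q x2 in
  let l3 := mult2 p q x3 in
  let s1 := l1 + l2 + l3 in
  let s2 := l1 * l2 + l1 * l3 + l2 * l3 in
  let S := spec3 rd s1 s2 1 in
  [/\ (S.2 != 0 <-> W1 rd p q a c),
      ((exists2 x : k, x != 2 & proj_eq S (1, x, 0)) <-> W2 rd p q [:: x1; x2; x3] a c),
      (forall x : k, x != 2 -> proj_eq S (1, x, 0) ->
         exists2 y : option K, y \in [:: x1; x2; x3] &
           v (mult2 p q y) = 1 /\ x = rd (mult2 p q y) + (rd (mult2 p q y))^-1),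
      (proj_eq S (1, 2, 0) <-> W3 rd p q [:: x1; x2; x3] a c)
    & (proj_eq S (0, 1, 0) <-> W4 rd p q [:: x1; x2; x3] a c)].
Proof.
move=> cop sz fpl c0 wt l1 l2 l3 s1 s2 S.
have sp : (size p <= 3)%N by rewrite -sz leq_maxl.
have sq : (size q <= 3)%N by rewrite -sz leq_maxr.
have [C C0 ffK] := fixpt_list_factors fpl sp.
have mu0 t : t \in [:: x1; x2; x3] -> mu p q t != 0.
  by move=> tin; apply: (mu_neq0 ffK).
have res0 : res2 p q != 0.
  by rewrite (res2_mu ffK) !mulf_neq0 ?mu0 ?inE ?eqxx ?orbT.
have [sig1E sig2E] := sigmas_mult ffK cop sz.
set P := (phi_conj p q a c).1; set Q := (phi_conj p q a c).2.
(* A zero pair would have zero resultant, against [res0] and [c0]. *)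
have PQ0 : (P != 0) || (Q != 0).
  apply: contraNT res0; rewrite negb_or !negbK => /andP[/eqP P0 /eqP Q0].
  have [rE _ _] := conj_invariants a c sp sq 1.
  have res00 : res2 (0 : {poly K}) 0 = 0 by rewrite /res2 !coef0; ring.
  move/eqP: rE; rewrite -/P -/Q P0 Q0 scaler0 res00.
  rewrite expr1n mul1r eq_sym mulf_eq0 => /orP[/eqP c60|/eqP->//].
  by have := expf_neq0 6 c0; rewrite c60 eqxx.
have [u0 Ff Gg fg0] := red_pairP rd PQ0.
move: u0 Ff Gg fg0; set u := maxcoef _ _; set f := (red_pair _ _).1.
set g := (red_pair _ _).2; set F := _ *: P; set G := _ *: Q => u0 Ff Gg fg0.
have fgE : phi_red rd p q a c = (f, g) by [].
have [rE s1E s2E] := conj_invariants a c sp sq u^-1.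
rewrite -/P -/Q -/F -/G in rE s1E s2E.
have [Rr Rs1 Rs2] := reduces_invariants Ff Gg.
have [sP sQ _] := phi_conj_coef a c sp sq; rewrite -/P -/Q in sP sQ.
have size3 (H : {poly K}) (h : {poly k}) : (size H <= 3)%N ->
    (forall i, reduces rd (u^-1 *: H)`_i h`_i) -> (size h <= 3)%N.
  move=> sH Hh; apply/leq_sizeP => i li.
  have [_ <-] := Hh i; rewrite coefZ nth_default ?mulr0 ?(leq_trans sH) //.
  by case: (reduces0 rd).
have sf := size3 _ _ sP Ff; have sg := size3 _ _ sQ Gg.
have resF0 : res2 F G != 0.
  rewrite rE; apply: mulf_neq0 => //.
  by apply: mulf_neq0; apply: expf_neq0; rewrite ?invr_eq0.
(* Over [K] the common factor from conjugating and rescaling cancels, so the normalized lift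
   computes the same projective point. *)
have SE : [|| sig1 f g != 0, sig2 f g != 0 | res2 f g != 0] ->
    exists2 e, e != 0 & S = (e * sig1 f g, e * sig2 f g, e * res2 f g).
  apply: (@spec3_proportional _ _ _ _ rd s1 s2 (res2 F G) (sig1 F G) (sig2 F G)) => //.
    by rewrite rE s1E -sig1E mulrCA.
  by rewrite rE s2E -sig2E mulrCA.
pose t1 := dir_cl rd a c x1; pose t2 := dir_cl rd a c x2; pose t3 := dir_cl rd a c x3.
have fixE : fixdirs rd [:: x1; x2; x3] a c = undup [:: t1; t2; t3] by [].
have [D ff] : exists D, fix_factors f g D t1 t2 t3.
  have [w1 [w10 X1 Y1]] := dir_coords rd a x1 c0.
  have [w2 [w20 X2 Y2]] := dir_coords rd a x2 c0.
  have [w3 [w30 X3 Y3]] := dir_coords rd a x3 c0.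
  have fK := conj_factors a c sp sq u^-1 w10 w20 w30 ffK.
  exact: (reduces_factors Ff Gg fK).
have multE x : x \in [:: x1; x2; x3] -> mu f g (dir_cl rd a c x) != 0 ->
    reduces rd (mult2 p q x) (tau f g (dir_cl rd a c x) / mu f g (dir_cl rd a c x)).
  move=> xin m0; have [w [w0 X Y]] := dir_coords rd a x c0.
  have [eF eG em] := conj_multiplier a c sp sq u^-1 w ffK xin (mu0 _ xin).
  exact: (reduces_multiplier Ff Gg X Y eF eG em m0).
have rle2 := rdeg_le2 sf sg.
rewrite /W1 /W2 /W3 /W4 /fixedII /branch_GFix /in_GFix fixE fgE size_undup3.
move: wt; rewrite /weight /fixedII /branch_GFix /Nmoved fixE fgE size_undup3.
case: excluded_middle_informative => fixed.
  have [r2 _|r2] := eqVneq (rdeg (f, g)) 2%N.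
    have rn := rdeg2_res2 ff sf sg fg0 r2.
    have [e e0 SeE] := SE (introT or3P (Or33 _ _ rn)).
    (* A nonzero resultant rules out the degree-one normal forms of (W2) and (W3). *)
    have nW2 ct : ~ conj_k (f, g) (ct *: 'X, 1).
      by rewrite -[_ *: 'X]addr0; apply: (@res2_not_conj _ f g ct 0).
    have nW3 at_ : ~ conj_k (f, g) ('X + at_%:P, 1).
      by rewrite -['X]scale1r; apply: (@res2_not_conj _ f g 1 at_).
    split; rewrite SeE.
    - by rewrite /= r2 mulf_neq0.
    - split=> [[x _ /(proj_eq_1x0 _ _ _ e0)[z]]|[_ [[ct _ /nW2]]]] //.
      by rewrite z eqxx in rn.
    - by move=> x _ /(proj_eq_1x0 _ _ _ e0)[z]; rewrite z eqxx in rn.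
    - split=> [/(proj_eq_1x0 _ _ _ e0)[z]|[_ [[at_ _ /nW3]]]] //.
      by rewrite z eqxx in rn.
    - by split=> [/(proj_eq_010 _ _ _ e0)[z]|[]] //; rewrite z eqxx in rn.
  have r1 : rdeg (f, g) = 1%N by case: (rdeg _) fixed rle2 r2 => [|[|[]]].
  (* In degree one the weight is the number of moved directions, so some direction of a fixed point
     is moved. *)
  rewrite r1 add0n ltz_nat -has_count => mv.
  have mv' : has (fun t => evalP1 (f, g) t != t) [:: t1; t2; t3].
    by move: mv; rewrite (eq_has_r (mem_undup _)).
  have [rz s1n sz2 tr] := rdeg1_type ff sf sg fg0 r1 mv'.
  have s2f : sig2 f g = 2 * sig1 f g - disc_fix f g by rewrite /sig2 rz mulr0 subr0.
  have [e e0 SeE] := SE (introT or3P (Or31 _ _ s1n)).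
  (* The ratio is 2 exactly when the discriminant vanishes, which separates (W2) from (W3). *)
  have x2E x : sig2 f g = x * sig1 f g -> x = 2 - disc_fix f g / sig1 f g.
    by rewrite s2f => h; apply: (mulIf s1n); rewrite -h; field.
  have S2 : S.2 = 0 by rewrite SeE /= rz mulr0.
  have nW1 : S.2 != 0 <-> (1 <= 1)%N /\ (2 <= 1)%N by rewrite S2 eqxx; split=> [|[]].
  have nW4 : proj_eq S (0, 1, 0) <-> ~ (1 <= 1)%N /\ uniq [:: t1; t2; t3].
    by rewrite SeE; split=> [/(proj_eq_010 _ _ _ e0)[_ z]|[]] //; rewrite z eqxx in s1n.
  (* Distinct directions make the point a branch point and give (W2); a coincidence gives (W3). *)
  case: ifP => ut; rewrite ut in nW4.
    case=> dn [ct ctP cn] [t tin [mt tt mtE]]; split=> //.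
    - split=> _; first by split=> //; split=> //; exists ct.
      exists (2 - disc_fix f g / sig1 f g).
        rewrite -subr_eq0 addrAC subrr sub0r oppr_eq0 mulf_neq0 ?invr_eq0 //.
      by rewrite SeE; apply/proj_eq_1x0 => //; split=> //; rewrite s2f; field.
    - move=> x _; rewrite SeE => /(proj_eq_1x0 _ _ _ e0)[_ _ /x2E ->].
      have [y yin ty] : exists2 y, y \in [:: x1; x2; x3] & t = dir_cl rd a c y.
        by apply/mapP.
      have red_y := multE y yin; rewrite -ty in red_y; have {}red_y := red_y mt.
      exists y => //; split.
        by apply: (reduces_unit red_y); rewrite mulf_neq0 ?invr_eq0.
      by case: red_y => _ ->; rewrite invf_div mtE.
    - rewrite SeE; split=> [/(proj_eq_1x0 _ _ _ e0)[_ _]|[_ [[at_ _ /tr d0]]]].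
        by rewrite s2f => /eqP; rewrite subr_eq addrC -subr_eq subrr eq_sym (negPf dn).
      by rewrite d0 eqxx in dn.
  case=> dz [at_ at0 cn]; have S12 : proj_eq S (1, 2, 0).
    by rewrite SeE; apply/proj_eq_1x0 => //; split=> //; rewrite s2f dz subr0.
  have xE2 x : proj_eq S (1, x, 0) -> x = 2.
    by rewrite SeE => /(proj_eq_1x0 _ _ _ e0)[_ _ /x2E ->]; rewrite dz mul0r subr0.
  split=> //.
  - by split=> [[x /eqP xn /xE2]|[_ [_]]] //.
  - by move=> x /eqP xn /xE2.
  - by split=> // _; split=> //; split=> //; exists at_.
(* A moved point that is not a branch point has weight 0, so positive weight leaves only (W4). *)
case: excluded_middle_informative => [ut _|//].
have r0 : rdeg (f, g) = 0%N by case: (rdeg _) fixed => // n [].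
have [rz s1z dn] := rdeg0_invariants ff fg0 r0 sf sg ut.
have s2n : sig2 f g != 0.
  by rewrite /sig2 rz s1z !mulr0 !sub0r oppr0 add0r oppr_eq0.
have [e e0 SeE] := SE (introT or3P (Or32 _ _ s2n)).
split; rewrite SeE.
- by split=> [|[]] //=; rewrite rz mulr0 eqxx.
- by split=> [[x _ /(proj_eq_1x0 _ _ _ e0)[_]]|[]] //; rewrite s1z eqxx.
- by move=> x _ /(proj_eq_1x0 _ _ _ e0)[_]; rewrite s1z eqxx.
- by split=> [/(proj_eq_1x0 _ _ _ e0)[_]|[]] //; rewrite s1z eqxx.
- by split=> // _; apply/proj_eq_010.
Qed.
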